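(* Let $G$ be a countable discrete abelian group, and let $\varphi,\psi:G\to G$ be homomorphisms such that $\varphi(G)$, $\psi(G)$ and $(\varphi-\psi)(G)$ all have finite index in $G$. Then for any ergodic measure-preserving $G$-system $(X,\mathcal{B},\mu,(T_g)_{g\in G})$, any $\varepsilon>0$, and any $A\in\mathcal{B}$, the set $$\left\{ g\in G : \mu\left(A\cap T_{\varphi(g)}^{-1}A\cap T_{\psi(g)}^{-1}A\right) > \mu(A)^3-\varepsilon\right\}$$ is syndetic in $G$.
   Context: A measure-preserving $G$-system is a separable probability space $(X,\mathcal{B},\mu)$ with an action of $G$ by measure-preserving automorphisms $T_g$; it is ergodic if every $A\in\mathcal B$ with $T_g^{-1}A=A$ for all $g$ has measure $0$ or $1$. A subset $S\subseteq G$ is syndetic if there are $g_1,\dots,g_k\in G$ with $G=\bigcup_{i=1}^k (g_i+S)$. *)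

(* Defs.v *)
From HB Require Import structures.
From mathcomp Require Import all_boot all_order all_algebra.
From mathcomp Require Import all_classical all_reals all_analysis.
Set Implicit Arguments. Unset Strict Implicit. Unset Printing Implicit Defensive.
Import Order.TTheory GRing.Theory Num.Theory.
Local Open Scope classical_set_scope.
Local Open Scope ring_scope.

Definition syndetic (G : zmodType) (S : set G) : Prop :=
  exists s : seq G, forall x : G, exists2 g, g \in s & S (x - g).

Definition finite_index (G : zmodType) (H : set G) : Prop :=
  exists s : seq G, forall x : G, exists2 c, c \in s & H (x - c).

Definition separable_prob d (X : measurableType d) (R : realType)
  (P : probability X R) : Prop :=
  exists F : nat -> set X, (forall n, measurable (F n)) /\
    forall A : set X, measurable A -> forall e : R, 0 < e ->
      exists n, (P ((A `\` F n) `|` (F n `\` A)) < e%:E)%E.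

Definition mp_action (G : zmodType) d (X : measurableType d) (R : realType)
  (P : probability X R) (T : G -> X -> X) : Prop :=
  [/\ (forall g, measurable_fun setT (T g)),
      (forall g A, measurable A -> P (T g @^-1` A) = P A),
      (forall x, T 0 x = x) &
      (forall g h x, T (g + h) x = T g (T h x))].

Definition ergodic_action (G : zmodType) d (X : measurableType d) (R : realType)
  (P : probability X R) (T : G -> X -> X) : Prop :=
  forall A : set X, measurable A -> (forall g, T g @^-1` A = A) ->
    P A = 0%E \/ P A = 1%E.

(* Main.v *)
(** The proof replaces the factor-theoretic machinery by L^2 arguments on bounded functions.

    Let f = 1_A and let k be the orthogonal projection of f onto the almost periodic
    functions; 0 <= k <= 1 because truncation to [0, 1] preserves almost periodicity.
    Put u = f - k. If the set of good g is not syndetic, there is an invariant mean m on G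
    giving it mass 0. Weight the averages by w(g) = max(0, delta - |T_phi(g) k - k|
    - |T_psi(g) k - k|), which has positive mean since k is almost periodic; where w > 0,
    the integral of k . T_phi(g) k . T_psi(g) k is at least (\int k)^3 - delta, and
    \int k = mu(A). It remains to see that f may be replaced by k in the w-weighted averages,
    i.e. that m_g w(g) \int f0 T_phi(g) u T_psi(g) f2 = 0 (and the same with phi and psi
    exchanged).

    First, u is weakly mixing along phi: the operator m_h <T_phi(h) u, .> T_phi(h) u is
    Hilbert-Schmidt and commutes with T_phi, so its range is almost periodic, hence
    orthogonal to u, and the operator vanishes. Second, van der Corput reduces the claim to
    the smallness, for most h, of m_g w(g + h) w(g) <a_h, T_(psi - phi)(g) b_h> with
    a_h = u T_phi(h) u and b_h = f2 T_psi(h) f2. Since w is almost periodic, w(g + h) may be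
    taken from a finite list of translates. For a fixed bounded weight, ergodicity and the
    finite index of (psi - phi)(G) make (a, b) |-> m_g w'(g) <a, T_(psi - phi)(g) b>
    a Hilbert-Schmidt form, while weak mixing of u makes the a_h asymptotically pairwise
    orthogonal; so the form is small on (a_h, b_h) for most h. *)
Require Import Defs.
From HB Require Import structures.
From mathcomp Require Import all_boot all_order all_algebra.
From mathcomp Require Import all_classical all_reals all_analysis.
From mathcomp Require Import measurable_realfun ring lra.
Set Implicit Arguments. Unset Strict Implicit. Unset Printing Implicit Defensive.
Import Order.TTheory GRing.Theory Num.Theory.
Import numFieldNormedType.Exports.
Local Open Scope classical_set_scope.
Local Open Scope ring_scope.

(** * Averages over finite lists *)

Section Averages.
Variables (R : realType) (I : Type).
Implicit Types (s : seq I) (u v : I -> R).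

Definition avg s u : R := (size s)%:R^-1 * \sum_(i <- s) u i.

Lemma avgD s u v : avg s (fun i => u i + v i) = avg s u + avg s v.
Proof. by rewrite /avg big_split mulrDr. Qed.

Lemma avgZ s c u : avg s (fun i => c * u i) = c * avg s u.
Proof. by rewrite /avg -mulr_sumr mulrCA. Qed.

Lemma avgB s u v : avg s (fun i => u i - v i) = avg s u - avg s v.
Proof. by rewrite /avg sumrB mulrBr. Qed.

Lemma eq_avg s u v : u =1 v -> avg s u = avg s v.
Proof. by move=> uv; rewrite /avg; congr (_ * _); apply: eq_bigr => i _. Qed.

Lemma size_gt0R s : s <> [::] -> 0 < (size s)%:R :> R.
Proof. by case: s => [//|x s _]; rewrite ltr0n. Qed.

Lemma avg_cst s c : s <> [::] -> avg s (fun=> c) = c.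
Proof.
move=> /size_gt0R s0; rewrite /avg big_const_seq count_predT iter_addr_0.
by rewrite -[c *+ _]mulr_natl mulrA mulVf ?mul1r ?gt_eqF.
Qed.

Lemma ler_avg s u v : (forall i, u i <= v i) -> avg s u <= avg s v.
Proof. by move=> uv; rewrite /avg ler_wpM2l ?invr_ge0// ler_sum. Qed.

Lemma avg_norm_le s u M : s <> [::] -> (forall i, `|u i| <= M) -> `|avg s u| <= M.
Proof.
move=> s0 uM; rewrite ler_norml -{1}(avg_cst (- M) s0) -{2}(avg_cst M s0).
by apply/andP; split; apply: ler_avg => i; have := uM i; rewrite ler_norml => /andP[].
Qed.

End Averages.

Lemma avg_map (R : realType) (I J : Type) (f : I -> J) (s : seq I) (u : J -> R) :
  avg (map f s) u = avg s (fun i => u (f i)).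
Proof. by rewrite /avg size_map big_map. Qed.

Lemma avg_allpairs (R : realType) (I J K : Type) (f : I -> J -> K) (s : seq I)
    (t : seq J) (u : K -> R) :
  avg [seq f a b | a <- s, b <- t] u = avg s (fun a => avg t (fun b => u (f a b))).
Proof.
by rewrite /avg size_allpairs big_allpairs_dep natrM invfM -mulrA mulr_sumr.
Qed.

Lemma exchange_avg (R : realType) (I J : Type) (s : seq I) (t : seq J)
    (u : I -> J -> R) :
  avg s (fun a => avg t (u a)) = avg t (fun b => avg s (u ^~ b)).
Proof. by rewrite /avg -!mulr_sumr exchange_big mulrCA. Qed.

(** * Invariant means on bounded functions, and limits along ultrafilters *)

Definition bddf (R : realType) (I : Type) (u : I -> R) :=
  exists M : R, forall i, `|u i| <= M.

Record invariant_mean (G : zmodType) (R : realType) (m : (G -> R) -> R) : Prop :=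
  InvariantMean {
    meanD : forall u v, bddf u -> bddf v -> m (fun g => u g + v g) = m u + m v;
    meanZ : forall c u, bddf u -> m (fun g => c * u g) = c * m u;
    ler_mean : forall u v, bddf u -> bddf v -> (forall g, u g <= v g) -> m u <= m v;
    mean_cst : forall c, m (fun=> c) = c;
    mean_shift : forall u h, bddf u -> m (fun g => u (g + h)) = m u }.

(** Compactness of the segment [[- M, M]] gives a cluster point, and an ultrafilter converges to
    each of its cluster points. *)
Lemma ultra_cvg_real (R : realType) (I : Type) (U : set_system I) (u : I -> R) (M : R) :
  UltraFilter U -> U [set i | `|u i| <= M] -> exists l : R, u i @[i --> U] --> l.
Proof.
move=> UU UM.
have PF : ProperFilter (u i @[i --> U]) by exact: fmap_proper_filter.
have := @segment_compact R (- M) M (u i @[i --> U]) PF.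
case.
  rewrite /nbhs/=; apply: filterS UM => i /=.
  by rewrite in_itv/= -ler_norml.
move=> l [_ lc]; exists l => V Vl.
case: (in_ultra_setVsetC (u @^-1` V) UU) => // UV.
have [|y [/= Vy]] := lc (~` V) V _ Vl; first by [].
by [].
Qed.

(** * An invariant mean giving mass 0 to a non-syndetic set *)

Section MeanExistence.
Variables (G : zmodType) (R : realType) (S : set G).
Hypothesis Snsyn : ~ syndetic S.

(* [L] is, up to order, a union of translates of [- s]; this is what makes averages
   over [L] almost invariant, and what survives passing to sumsets. *)
Let tiled (s L : seq G) := exists2 t : seq G, t <> [::] &
  forall u : G -> R, avg L u = avg t (fun b => avg s (fun a => u (b - a))).

Let avoid (L : seq G) := L <> [::] /\ (forall g, g \in L -> ~ S g).

(** An ultrafilter containing this filter concentrates on lists that avoid [S] and, for each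
    nonempty [s], are tiled by [s]. Limits of averages along it are then shift-invariant and vanish
    at the indicator of [S]. *)
Let tiles : set_system (seq G) := [set Q | exists2 s : seq G, s <> [::] &
  forall L, avoid L -> tiled s L -> Q L].

Let sumset (s t : seq G) := [seq a + b | a <- s, b <- t].

Let sumset_nil s t : s <> [::] -> t <> [::] -> sumset s t <> [::].
Proof. by case: s => // a s _; case: t. Qed.

(** Commutativity lets a tile shaped like the sumset be cut into tiles of either shape, so that
    [tiles] is closed under intersection. *)
Let tiled_sumset s t L : s <> [::] -> t <> [::] ->
  tiled (sumset s t) L -> tiled s L /\ tiled t L.
Proof.
move=> s0 t0 [r r0 rL]; split.
  exists [seq b - a | b <- r, a <- t]; first by case: r r0 {rL} => // b r _; case: t t0.
  move=> u; rewrite rL avg_allpairs; apply: eq_avg => b.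
  rewrite avg_allpairs exchange_avg; apply: eq_avg => c; apply: eq_avg => a.
  by rewrite opprD addrA addrAC.
exists [seq b - a | b <- r, a <- s]; first by case: r r0 {rL} => // b r _; case: s s0.
move=> u; rewrite rL avg_allpairs; apply: eq_avg => b.
rewrite avg_allpairs; apply: eq_avg => a; apply: eq_avg => c.
by rewrite opprD addrA.
Qed.

Let tiles_proper : ProperFilter tiles.
Proof.
split.
  move=> [s s0 H].
  (* Were there no such [x], the list [s] would witness that [S] is syndetic. The list [x - s] is
     then a single tile avoiding [S]. *)
  have [x xS] : exists x, forall g, g \in s -> ~ S (x - g).
    apply: contrapT => nx; apply: Snsyn; exists s => x.
    apply: contrapT => nxs; apply: nx; exists x => g gs Sxg.
    by apply: nxs; exists g.
  apply: (H [seq x - a | a <- s]).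
    by split=> [|g /mapP[a /xS ? ->//]]; case: s s0 {H xS}.
  exists [:: x] => // u.
  by rewrite avg_map [in RHS]/avg big_seq1 invr1 mul1r.
split.
- by exists [:: 0].
- move=> Q1 Q2 [s s0 sQ] [t t0 tQ]; exists (sumset s t); first exact: sumset_nil.
  by move=> L aL /(tiled_sumset s0 t0)[? ?]; split; [exact: sQ|exact: tQ].
- by move=> Q1 Q2 Q12 [s s0 sQ]; exists s => // L aL tL; apply/Q12/sQ.
Qed.

(** Along a progression of step [h], a shift by [h] only affects the two ends, so the average over
    [n] terms moves by at most [2 M / n] when [u] is bounded by [M]. *)
Let telescope_orbit (u : G -> R) (b h : G) (n : nat) :
  \sum_(a <- [seq h *+ i | i <- iota 0 n]) (u (b - a + h) - u (b - a)) =
  u (b + h) - u (b + h - h *+ n).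
Proof.
elim: n => [|n IHn]; first by rewrite big_nil subr0 subrr.
rewrite -addn1 iotaD map_cat big_cat/= IHn big_seq1 add0n mulrnDr mulr1n opprD.
rewrite (addrA (b + h)) -(addrAC b) [b - _ + h - h]addrK; ring.
Qed.

Lemma nonsyndetic_mean : exists2 m : (G -> R) -> R, invariant_mean m & m \1_S = 0.
Proof.
have [U [UU FU]] := ultraFilterLemma tiles_proper.
have PU : ProperFilter U by exact: ultra_proper.
have Uavoid : U avoid by apply: FU; exists [:: 0].
have cv (u : G -> R) : bddf u -> exists l : R, avg L u @[L --> U] --> l.
  move=> [M uM]; apply: (@ultra_cvg_real _ _ _ _ M) => //.
  by apply: filterS Uavoid => L [L0 _]/=; exact: avg_norm_le.
pose m (u : G -> R) : R := lim (avg L u @[L --> U]).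
have cvm u : bddf u -> avg L u @[L --> U] --> m u.
  by move=> /cv[l ul]; rewrite /m (cvg_lim _ ul).
have mE u l : avg L u @[L --> U] --> l -> m u = l by move=> ul; exact: cvg_lim ul.
exists m.
  split.
  - move=> u v bu bv; apply: mE; rewrite (_ : (fun L => _) = fun L => avg L u + avg L v).
      by apply: cvgD; exact: cvm.
    by apply/funext => L; rewrite avgD.
  - move=> c u bu; apply: mE; rewrite (_ : (fun L => _) = fun L => c * avg L u).
      by apply: cvgMr; exact: cvm.
    by apply/funext => L; rewrite avgZ.
  - move=> u v bu bv uv; rewrite -subr_ge0.
    have c : avg L v - avg L u @[L --> U] --> m v - m u by apply: cvgB; exact: cvm.
    rewrite -(cvg_lim _ c) //.
    apply: limr_ge; first exact: cvgP c.
    by apply: nearW => L; rewrite subr_ge0; exact: ler_avg.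
  - move=> c; apply: mE; apply: cvg_near_cst; apply: filterS Uavoid => L [L0 _].
    by rewrite avg_cst.
  - move=> u h bu; have [M uM] := bu.
    have bv : bddf (fun g => u (g + h)) by exists M => g.
    apply: mE; rewrite (_ : (fun L => _) =
      fun L => avg L (fun g => u (g + h) - u g) + avg L u); last first.
      by apply/funext => L; rewrite -avgD; apply: eq_avg => g; rewrite subrK.
    rewrite -[m u]add0r; apply: cvgD; last exact: cvm.
    apply/cvgr0Pnorm_le => e e0.
    have M0 : 0 <= M by exact: le_trans (uM 0).
    (* The progression has [n.+1 > 2 M / e] terms, which brings the boundary terms below [e]. *)
    pose n := Num.truncn (2 * M / e).
    apply: FU; exists [seq h *+ i | i <- iota 0 n.+1] => // L _ [t t0 ->].
    apply: avg_norm_le => // b.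
    rewrite /avg telescope_orbit size_map size_iota normrM.
    rewrite ger0_norm ?invr_ge0// ler_pdivrMl ?ltr0n//.
    apply: (@le_trans _ _ (2 * M)).
      apply: (le_trans (ler_normB _ _)).
      by rewrite mulr_natl mulr2n; apply: lerD.
    rewrite -ler_pdivrMr// ltW//.
    by have /truncn_itv/andP[] : 0 <= 2 * M / e by rewrite divr_ge0 ?mulr_ge0 // ltW.
apply: mE; apply: cvg_near_cst; apply: filterS Uavoid => L [L0 LS].
rewrite /avg big_seq big1 ?mulr0// => g /LS Sg.
by rewrite indicE memNset.
Qed.

End MeanExistence.

(** * Closure properties of bounded functions *)

Section Bounded.
Variables (R : realType) (I : Type).
Implicit Types u v : I -> R.

Lemma bddf_cst (c : R) : bddf (fun _ : I => c).
Proof. by exists `|c|. Qed.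

Lemma bddfD u v : bddf u -> bddf v -> bddf (fun g => u g + v g).
Proof.
move=> [M uM] [N vN]; exists (M + N) => g.
by apply: le_trans (ler_normD _ _) _; exact: lerD.
Qed.

Lemma bddfM u v : bddf u -> bddf v -> bddf (fun g => u g * v g).
Proof.
by move=> [M uM] [N vN]; exists (M * N) => g; rewrite normrM; exact: ler_pM.
Qed.

Lemma bddfN u : bddf u -> bddf (fun g => - u g).
Proof. by move=> [M uM]; exists M => g; rewrite normrN. Qed.

Lemma bddfB u v : bddf u -> bddf v -> bddf (fun g => u g - v g).
Proof. by move=> bu bv; apply: bddfD => //; exact: bddfN. Qed.

Lemma bddf_norm u : bddf u -> bddf (fun g => `|u g|).
Proof. by move=> [M uM]; exists M => g; rewrite normr_id. Qed.

Lemma bddf_sum (J : Type) (s : seq J) (u : J -> I -> R) :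
  (forall j, bddf (u j)) -> bddf (fun g => \sum_(j <- s) u j g).
Proof.
move=> bu; elim: s => [|j s IHs].
  by exists 0 => g; rewrite big_nil normr0.
under eq_fun do rewrite big_cons.
by apply: bddfD.
Qed.

Lemma bddf_comp (J : Type) (f : J -> I) u : bddf u -> bddf (fun g => u (f g)).
Proof. by move=> [M uM]; exists M => g. Qed.

Lemma bddf_indic (D : set I) : bddf (\1_D : I -> R).
Proof. by exists 1 => g; rewrite indicE ger0_norm ?ler0n// lern1 leq_b1. Qed.

End Bounded.

(** * Calculus of invariant means and null sets *)

Section Means.
Variables (G : zmodType) (R : realType) (m : (G -> R) -> R).
Hypothesis hm : invariant_mean m.
Implicit Types (u v : G -> R) (D : set G).

Lemma meanN u : bddf u -> m (fun g => - u g) = - m u.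
Proof.
move=> bu; rewrite -[RHS]mulN1r -(meanZ hm _ bu); congr m.
by apply/funext => g; rewrite mulN1r.
Qed.

Lemma meanB u v : bddf u -> bddf v -> m (fun g => u g - v g) = m u - m v.
Proof. by move=> bu bv; rewrite (meanD hm) ?meanN//; exact: bddfN. Qed.

Lemma mean_sum (J : Type) (s : seq J) (u : J -> G -> R) :
  (forall j, bddf (u j)) -> m (fun g => \sum_(j <- s) u j g) = \sum_(j <- s) m (u j).
Proof.
move=> bu; elim: s => [|j s IHs].
  by under eq_fun do rewrite big_nil; rewrite (mean_cst hm) big_nil.
under eq_fun do rewrite big_cons.
by rewrite (meanD hm) ?IHs ?big_cons//; exact: bddf_sum.
Qed.

Lemma mean_ge0 u : bddf u -> (forall g, 0 <= u g) -> 0 <= m u.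
Proof.
by move=> bu u0; rewrite -(mean_cst hm 0); apply: (ler_mean hm) => //; exact: bddf_cst.
Qed.

Lemma ler_norm_mean u v : bddf u -> bddf v -> (forall g, `|u g| <= v g) -> `|m u| <= m v.
Proof.
move=> bu bv uv; rewrite ler_norml -meanN//; apply/andP; split.
  apply: (ler_mean hm) => //; first exact: bddfN.
  by move=> g; have := uv g; rewrite ler_norml => /andP[].
by apply: (ler_mean hm) => // g; apply: le_trans (uv g); exact: ler_norm.
Qed.

Definition null D := m \1_D = 0.

Lemma mean_indic_ge0 D : 0 <= m \1_D.
Proof. by apply: mean_ge0; [exact: bddf_indic|move=> g; rewrite indicE ler0n]. Qed.

Lemma null_bound D v : bddf v -> m v = 0 -> (forall g, 0 <= v g) ->
  (forall g, D g -> 1 <= v g) -> null D.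
Proof.
move=> bv v0 vge0 Dv; apply/eqP; rewrite eq_le mean_indic_ge0 andbT -v0.
apply: (ler_mean hm) => //; first exact: bddf_indic.
move=> g; rewrite indicE; case: (boolP (g \in D)) => [|_]; last exact: vge0.
by rewrite inE => /Dv.
Qed.

Lemma null_sub D D' : D `<=` D' -> null D' -> null D.
Proof.
move=> DD D'0; apply: (null_bound (bddf_indic _ D') D'0) => g.
  by rewrite indicE ler0n.
by move=> /DD D'g; rewrite indicE mem_set.
Qed.

Lemma null_setU D D' : null D -> null D' -> null (D `|` D').
Proof.
move=> D0 D'0.
have bi E : bddf (\1_E : G -> R) by exact: bddf_indic.
apply: (@null_bound _ (fun g => \1_D g + \1_D' g)).
- exact: bddfD.
- by rewrite (meanD hm) // D0 D'0 addr0.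
- by move=> g; rewrite !indicE addr_ge0.
- by move=> g [Dg|Dg]; rewrite !indicE (mem_set Dg) ?lerDl ?lerDr ler0n.
Qed.

Lemma null_set0 : null set0.
Proof.
apply: (null_bound (bddf_cst G 0) (mean_cst hm 0)) => //.
Qed.

Lemma null_bigcup (J : eqType) (s : seq J) (D : J -> set G) :
  (forall j, j \in s -> null (D j)) -> null [set g | exists2 j, j \in s & D j g].
Proof.
elim: s => [|j s IHs] sD.
  by apply: null_sub null_set0 => g [].
have js : null [set g | exists2 j, j \in s & D j g].
  by apply: IHs => k ks; apply: sD; rewrite in_cons ks orbT.
apply: null_sub (null_setU (sD j (mem_head _ _)) js) => g [k].
by rewrite in_cons => /predU1P[->|ks] Dk; [left|right; exists k].
Qed.

Lemma null_shift D h : null D -> null [set g | D (g + h)].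
Proof.
by rewrite /null => <-; exact: (mean_shift hm h (bddf_indic _ D)).
Qed.

Lemma null_markov u c : bddf u -> (forall g, 0 <= u g) -> m u = 0 -> 0 < c ->
  null [set g | c < u g].
Proof.
move=> bu u0 mu c0; apply: (@null_bound _ (fun g => c^-1 * u g)).
- by apply: bddfM => //; exact: bddf_cst.
- by rewrite (meanZ hm) // mu mulr0.
- by move=> g; rewrite mulr_ge0 // invr_ge0 ltW.
- by move=> g /= cu; rewrite ler_pdivlMl // mulr1 ltW.
Qed.

(** Finitely many translates of [D], all of the same mean, cover [G], so their means add up to at
    least 1. *)
Lemma mean_syndetic_gt0 D : syndetic D -> 0 < m \1_D.
Proof.
move=> [s sD].
have bD h : bddf (fun g => \1_D (g - h) : R).
  exact: (bddf_comp (fun g => g - h) (bddf_indic R D)).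
have : 1 <= \sum_(h <- s) m (fun g => \1_D (g - h)).
  rewrite -mean_sum // -[leLHS](mean_cst hm); apply: (ler_mean hm).
  - exact: bddf_cst.
  - exact: bddf_sum.
  - move=> g; have [h hs Dgh] := sD g.
    rewrite (big_rem h) //= indicE mem_set // lerDl.
    by apply: sumr_ge0 => i _; rewrite indicE ler0n.
under eq_bigr do rewrite (mean_shift hm _ (bddf_indic R D)).
rewrite lt_neqAle mean_indic_ge0 andbT; apply: contraTneq => <-.
by rewrite big1 // -ltNge ltr01.
Qed.

(** Greedy choice: at each step the points that fail [r] with an earlier one form a finite union of
    null sets, which cannot contain [D]. The relation is obtained only from earlier to later
    indices. *)
Lemma exists_pairwise D (r : G -> G -> Prop) : ~ null D ->
  (forall h, null [set h' | ~ r h h']) -> forall n, exists h : nat -> G,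
  (forall i, (i < n)%N -> D (h i)) /\
  (forall i j, (i < j)%N -> (j < n)%N -> r (h i) (h j)).
Proof.
move=> Dn0 rn; elim=> [|n [h [hD hr]]]; first by exists (fun=> 0).
have [x [Dx xr]] : exists x, D x /\ forall i, (i < n)%N -> r (h i) x.
  apply: contrapT => nx; apply: Dn0.
  have := @null_bigcup _ (iota 0 n) (fun i => [set x | ~ r (h i) x]) (fun i _ => rn (h i)).
  apply: null_sub => x Dx; apply: contrapT => /= nxi; apply: nx; exists x; split=> // i ltin.
  apply: contrapT => nrx; apply: nxi; exists i => //.
  by rewrite mem_iota add0n ltin.
exists (fun i => if (i < n)%N then h i else x); split=> [i|i j].
  by move=> _; case: ifP => // /hD.
rewrite ltnS => ltij lejn; have ltin := leq_trans ltij lejn; rewrite ltin.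
by case: ifP => ltjn; [exact: hr|exact: xr].
Qed.

End Means.

(** * The ring of bounded measurable functions *)

Section BoundedMeasurable.
Variables (d : measure_display) (X : measurableType d) (R : realType).

Definition bmf : {pred X -> R} := mem [set f | measurable_fun setT f /\ bddf f].

(** Genuine functions rather than classes modulo null sets, so that they form a commutative ring
    under pointwise product; equality in L^2 is expressed by a vanishing norm. *)
Record bfun : Type := BFun { bfun_fun :> X -> R; bfun_subproof : bfun_fun \in bmf }.

HB.instance Definition _ := [isSub for bfun_fun].
HB.instance Definition _ := [Choice of bfun by <:].

Lemma bmf_subring_closed : subring_closed bmf.
Proof.
split.
- by rewrite inE; split; [exact: measurable_cst|exact: bddf_cst].
- move=> f g; rewrite !inE => -[mf bf] [mg bg]; split; last exact: bddfB.
  exact: measurable_funB.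
- move=> f g; rewrite !inE => -[mf bf] [mg bg]; split; last exact: bddfM.
  exact: measurable_funM.
Qed.

HB.instance Definition _ := GRing.isSubringClosed.Build (X -> R) bmf bmf_subring_closed.
HB.instance Definition _ := [SubChoice_isSubComNzRing of bfun by <:].

Implicit Types a b : bfun.

Lemma bfun_ext a b : (forall x, a x = b x) -> a = b.
Proof. by move=> ab; apply/val_inj/funext. Qed.

Lemma bfunD a b x : (a + b) x = a x + b x. Proof. by []. Qed.
Lemma bfunN a x : (- a) x = - a x. Proof. by []. Qed.
Lemma bfunM a b x : (a * b) x = a x * b x. Proof. by []. Qed.

Lemma bfun_sum (I : Type) (s : seq I) (F : I -> bfun) x :
  (\sum_(i <- s) F i) x = \sum_(i <- s) F i x.
Proof. by elim: s => [|i s IHs]; rewrite !(big_nil, big_cons) ?bfunD ?IHs. Qed.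

Lemma bfun_measurable a : measurable_fun setT a.
Proof. by have := bfun_subproof a; rewrite inE => -[]. Qed.

Lemma bfun_bdd a : bddf a.
Proof. by have := bfun_subproof a; rewrite inE => -[]. Qed.

Lemma bfunM_le1 a b : (forall x, `|a x| <= 1) -> (forall x, `|b x| <= 1) ->
  forall x, `|(a * b) x| <= 1.
Proof. by move=> a1 b1 x; rewrite bfunM normrM -(mulr1 1); apply: ler_pM. Qed.

Lemma bmf_mem (f : X -> R) : measurable_fun setT f -> bddf f -> f \in bmf.
Proof. by rewrite inE. Qed.

(** Scalars enter as constant functions, so that scaling is a product in the ring [bfun]. *)
Definition cb (c : R) : bfun :=
  BFun (bmf_mem (measurable_cst c) (bddf_cst X c)).

Lemma cbE c x : cb c x = c. Proof. by []. Qed.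

Lemma cb_is_zmod_morphism : zmod_morphism cb.
Proof. by move=> c c'; apply: bfun_ext. Qed.
Lemma cb_is_monoid_morphism : monoid_morphism cb.
Proof. by split=> [|c c']; apply: bfun_ext. Qed.
HB.instance Definition _ := GRing.isZmodMorphism.Build _ _ cb cb_is_zmod_morphism.
HB.instance Definition _ := GRing.isMonoidMorphism.Build _ _ cb cb_is_monoid_morphism.

Lemma clip_bmf a : (fun x => Num.min 1 (Num.max 0 (a x))) \in bmf.
Proof.
apply: bmf_mem.
  apply: measurable_minr; first exact: measurable_cst.
  by apply: measurable_maxr; [exact: measurable_cst|exact: bfun_measurable].
exists 1 => x; rewrite ger0_norm; first by rewrite ge_min lexx.
by rewrite le_min ler01 le_max lexx.
Qed.
Definition clip a : bfun := BFun (clip_bmf a).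

Lemma norm_bmf a : (fun x => `|a x|) \in bmf.
Proof.
apply: bmf_mem; last exact/bddf_norm/bfun_bdd.
by apply: measurableT_comp => //; exact: bfun_measurable.
Qed.
Definition bnorm a : bfun := BFun (norm_bmf a).

Lemma indic_bmf (A : set X) : measurable A -> (\1_A : X -> R) \in bmf.
Proof. by move=> mA; apply: bmf_mem; [exact: measurable_indic|exact: bddf_indic]. Qed.
Definition bindic (A : set X) (mA : measurable A) : bfun := BFun (indic_bmf mA).

Lemma bfun_comp_bmf a (T : X -> X) : measurable_fun setT T -> (fun x => a (T x)) \in bmf.
Proof.
move=> mT; apply: bmf_mem; last exact/bddf_comp/bfun_bdd.
by apply: measurableT_comp => //; exact: bfun_measurable.
Qed.

End BoundedMeasurable.
Arguments cb {d X R} c.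

(** * Expectation of bounded functions *)

Section Expectation.
Variables (d : measure_display) (X : measurableType d) (R : realType).
Variable P : probability X R.
Notation V := (bfun X R).
Implicit Types a b : V.

Lemma bfun_integrable a : P.-integrable setT (EFin \o a).
Proof.
have [M aM] := bfun_bdd a.
apply: measurable_bounded_integrable => //.
- by rewrite /= (@probability_setT _ _ _ P) ltry.
- exact: bfun_measurable.
- by exists M; split; [exact: num_real|move=> y My x _; apply: le_trans (aM x) (ltW My)].
Qed.

(* Locked so that unification never unfolds the integral. *)
Fact EE_key : unit. Proof. exact: tt. Qed.
Definition EE : V -> R := locked_with EE_key (fun a => \int[P]_x a x).

Lemma EE_Rintegral a : EE a = \int[P]_x a x. Proof. by rewrite /EE unlock. Qed.

Lemma EE_is_zmod_morphism : zmod_morphism EE.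
Proof. by move=> a b; rewrite !EE_Rintegral -RintegralB//; exact: bfun_integrable. Qed.
HB.instance Definition _ := GRing.isZmodMorphism.Build V R EE EE_is_zmod_morphism.

Lemma EE_fin a : (\int[P]_x (a x)%:E)%E = (EE a)%:E.
Proof.
by rewrite EE_Rintegral fineK//; apply: integrable_fin_num => //; exact: bfun_integrable.
Qed.

Lemma EEZ c a : EE (cb c * a) = c * EE a.
Proof. by rewrite !EE_Rintegral -RintegralZl//; exact: bfun_integrable. Qed.

Lemma EE_cst c : EE (cb c) = c.
Proof.
rewrite EE_Rintegral Rintegral_cst// /= (@probability_setT _ _ _ P).
by rewrite mulr1.
Qed.

Lemma EE1 : EE 1 = 1. Proof. by rewrite -(EE_cst 1) rmorph1. Qed.

Lemma EE_ge0 a : (forall x, 0 <= a x) -> 0 <= EE a.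
Proof. by move=> a0; rewrite EE_Rintegral; apply: Rintegral_ge0. Qed.

Lemma ler_EE a b : (forall x, a x <= b x) -> EE a <= EE b.
Proof.
by move=> ab; rewrite -subr_ge0 -raddfB; apply: EE_ge0 => x; rewrite bfunD bfunN subr_ge0.
Qed.

Lemma EE_indic (A : set X) (mA : measurable A) : (EE (bindic R mA))%:E = P A.
Proof. by rewrite -EE_fin/= integral_indic// setIT. Qed.

Lemma EE_ae0 a : (\forall x \ae P, a x = 0) -> EE a = 0.
Proof.
move=> a0; apply: EFin_inj; rewrite -EE_fin.
rewrite (ae_eq_integral (cst 0%E)) ?integral0//.
- by apply/measurable_EFinP; exact: bfun_measurable.
- by apply: filterS a0 => x /= -> _.
Qed.

End Expectation.

(** * Completeness of bounded sets of functions in L^2 *)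

Section Completeness.
Variables (d : measure_display) (X : measurableType d) (R : realType).
Variable P : probability X R.
Notation V := (bfun X R).
Notation EE := (EE P).
Implicit Types a b : V.

Lemma EE_eq0_ae a : (forall x, 0 <= a x) -> EE a = 0 -> \forall x \ae P, a x = 0.
Proof.
move=> a0 Ea.
have ma : measurable_fun setT (EFin \o a).
  by apply/measurable_EFinP; exact: bfun_measurable.
have : (\int[P]_x `|(EFin \o a) x| = 0)%E.
  rewrite -[RHS]/(0%:E) -Ea -EE_fin; apply: eq_integral => x _ /=.
  by rewrite ger0_norm.
move=> /(ae_eq_integral_abs P measurableT ma); apply: filterS => x /(_ I)/= [].
exact.
Qed.

(** Pointwise [|t| <= (c + t ^ 2 / c) / 2], integrated against the probability [P]. *)
Lemma EE_norm_le_sq a (c : R) : 0 < c -> EE (a * a) <= c ^+ 2 -> EE (bnorm a) <= c.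
Proof.
move=> c0 ac.
have : EE (bnorm a) <= EE (cb (2^-1) * (cb c + cb (c^-1) * (a * a))).
  apply: ler_EE => x; rewrite !bfunM bfunD !bfunM !cbE /=.
  rewrite -expr2 -real_normK ?num_real//; set t := `|a x|.
  have : 0 <= (c - t) ^+ 2 / c by rewrite divr_ge0 ?sqr_ge0 // ltW.
  have -> : (c - t) ^+ 2 / c = c - 2 * t + c^-1 * t ^+ 2 by field; rewrite gt_eqF.
  lra.
move=> /le_trans; apply; rewrite EEZ raddfD/= EE_cst EEZ.
have : c^-1 * EE (a * a) <= c by rewrite ler_pdivrMl // -expr2.
lra.
Qed.

(** The increments have total L^1 norm at most 2, so their series converges absolutely almost
    everywhere. *)
Lemma increments_ae_cvg (f_ : nat -> V) :
  (forall n, EE (bnorm (f_ n.+1 - f_ n)) <= 2^-1 ^+ n) ->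
  \forall x \ae P, cvgn (fun n => f_ n x).
Proof.
move=> fle.
pose h n x := (bnorm (f_ n.+1 - f_ n) x)%:E.
have h0 n x : (0 <= h n x)%E by rewrite lee_fin /= normr_ge0.
have mh n : measurable_fun setT (h n).
  by apply/measurable_EFinP; exact: bfun_measurable.
pose H x := (\sum_(0 <= n <oo) h n x)%E.
have mH : measurable_fun setT H by apply: ge0_emeasurable_sum.
have H0 x : (0 <= H x)%E by apply: nneseries_ge0.
have Hint : P.-integrable setT H.
  apply/integrableP; split=> //.
  under eq_integral do rewrite gee0_abs//.
  rewrite /H integral_nneseries//.
  apply: (@le_lt_trans _ _ 2%:E); last by rewrite ltry.
  apply: lime_le.
    by apply: is_cvg_nneseries => n _ _; exact: integral_ge0.
  apply: nearW => n.
  rewrite (eq_bigr (fun i => (EE (bnorm (f_ i.+1 - f_ i)))%:E)); last first.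
    by move=> i _; rewrite -EE_fin.
  rewrite sumEFin lee_fin.
  apply: (@le_trans _ _ (series (geometric 1 2^-1) n)).
    rewrite seriesEnat/=; apply: ler_sum => i _.
    by apply: le_trans (fle i) _; rewrite /geometric/= mul1r.
  have e2 : 1 / (1 - 2^-1) = 2 :> R by field.
  rewrite -[leRHS]e2; apply: geometric_le_lim => //; rewrite ?invr_gt0//.
  by rewrite ger0_norm ?invr_ge0//; lra.
have := integrable_ae measurableT Hint; apply: filterS => x /(_ I) Hx.
have cs : cvgn (series (fun n => f_ n.+1 x - f_ n x)).
  apply: normed_cvg; apply: nondecreasing_is_cvgn.
    apply/nondecreasing_seqP => n /=; rewrite !seriesEnat /= big_nat_recr //=.
    by rewrite lerDl.
  exists (fine (H x)) => _ [n _ <-]; rewrite /normed_series_of seriesEnat /=.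
  rewrite -lee_fin fineK // -sumEFin.
  exact: (@nneseries_lim_ge _ (h ^~ x) predT 0%N n).
have -> : (fun n => f_ n x) =
    (fun n => f_ 0%N x + series (fun n => f_ n.+1 x - f_ n x) n).
  by apply/funext => n; rewrite seriesEnat/= telescope_sumr// addrC subrK.
by apply: is_cvgD => //; exact: is_cvg_cst.
Qed.

(** [4^-1 ^+ n] is the square of the rate [2^-1 ^+ n], fast enough for almost everywhere
    convergence; dominated convergence in the second index then passes the bound to the limit. *)
Lemma bfun_complete (f_ : nat -> V) (M : R) :
  (forall n x, `|f_ n x| <= M) ->
  (forall n k, EE ((f_ n - f_ (n + k)%N) * (f_ n - f_ (n + k)%N)) <= 4^-1 ^+ n) ->
  exists f : V, (forall x, `|f x| <= M) /\
    forall n, EE ((f_ n - f) * (f_ n - f)) <= 4^-1 ^+ n.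
Proof.
move=> fM fC.
have M0 : 0 <= M by exact: le_trans (fM 0%N point).
have fcv : \forall x \ae P, cvgn (fun n => f_ n x).
  apply: increments_ae_cvg => n; apply: EE_norm_le_sq.
    by rewrite exprn_gt0// invr_gt0.
  have := fC n 1%N; rewrite addn1 -exprM mulnC exprM expr2.
  have -> : 2^-1 * 2^-1 = 4^-1 :> R by lra.
  by rewrite -[f_ n.+1 - _]opprB mulrNN.
(* The upper limit is measurable whether or not the sequence converges at [x]; truncating it to
   [[- M, M]] in [g] gives a function bounded everywhere. *)
pose l x := fine (limn_esup (fun n => (f_ n x)%:E)).
have ml : measurable_fun setT l.
  apply: measurableT_comp; first exact: (fine_measurable measurableT).
  apply: measurable_fun_limn_esup => n.
  by apply/measurable_EFinP; exact: bfun_measurable.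
pose g x : R := Num.max (- M) (Num.min M (l x)).
have gb x : `|g x| <= M.
  rewrite ler_norml le_max lexx /= ge_max ge_min lexx /= andbT.
  by rewrite (le_trans _ M0)// oppr_le0.
have gP : g \in @bmf _ X R.
  apply: bmf_mem; last by exists M.
  apply: measurable_maxr; first exact: measurable_cst.
  by apply: measurable_minr => //; exact: measurable_cst.
pose f := BFun gP; exists f; split=> // n.
have fl : \forall x \ae P, f_ n x @[n --> \oo] --> f x.
  apply: filterS fcv => x cx.
  have lE : l x = limn (fun n => f_ n x).
    have ecx : (f_ n x)%:E @[n --> \oo] --> (limn (fun n => f_ n x))%:E.
      by apply/fine_cvgP; split; [exact: nearW|exact: cx].
    by rewrite /l (cvg_limn_einf_sup ecx).2.
  suff -> : f x = limn (fun n => f_ n x) by exact: cx.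
  rewrite -lE /f /= /g.
  have lM : l x <= M.
    rewrite lE; apply: limr_le => //; apply: nearW => k.
    by have := fM k x; rewrite ler_norml => /andP[].
  have Ml : - M <= l x.
    rewrite lE; apply: limr_ge => //; apply: nearW => k.
    by have := fM k x; rewrite ler_norml => /andP[].
  by rewrite (min_idPr lM) (max_idPr Ml).
pose F k : V := (f_ n - f_ k) * (f_ n - f_ k).
pose F0 : V := (f_ n - f) * (f_ n - f).
have mb (a : V) : measurable_fun setT (EFin \o a).
  by apply/measurable_EFinP; exact: bfun_measurable.
have Fcv : \forall x \ae P, setT x ->
    (EFin \o F k) x @[k --> \oo] --> (EFin \o F0) x.
  apply: filterS fl => x cx _; apply/fine_cvgP; split; first exact: nearW.
  apply: cvgM; apply: cvgB => //; exact: cvg_cst.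
have FM : \forall x \ae P, forall k, setT x ->
    (`|(EFin \o F k) x| <= (EFin \o (cb ((M + M) ^+ 2) : V)) x)%E.
  apply: aeW => x k _; rewrite /= lee_fin normrM -expr2 lerXn2r ?nnegrE ?addr_ge0//.
  by apply: le_trans (ler_normB _ _) _; exact: lerD.
have [_ _ Fc] := dominated_convergence measurableT (fun k => mb (F k)) (mb F0) Fcv
  (bfun_integrable P _) FM.
rewrite -lee_fin -EE_fin -[leLHS](cvg_lim _ Fc) //.
apply: lime_le; first exact: cvgP Fc.
near=> k; rewrite [leLHS](EE_fin P (F k)) lee_fin /F.
have /subnKC <- : (n <= k)%N by near: k; exact: nbhs_infty_ge.
exact: fC.
Unshelve. all: by end_near.
Qed.

End Completeness.

(** * The action on functions by composition *)

Section Action.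
Variables (G : zmodType) (d : measure_display) (X : measurableType d) (R : realType).
Variables (P : probability X R) (T : G -> X -> X).
Hypothesis Hact : mp_action P T.
Notation V := (bfun X R).
Notation EE := (EE P).
Implicit Types a b : V.

Lemma act_measurable g : measurable_fun setT (T g).
Proof. by case: Hact. Qed.

Definition act g a : V := BFun (bfun_comp_bmf a (act_measurable g)).

Lemma actE g a x : act g a x = a (T g x). Proof. by []. Qed.

Lemma act_is_zmod_morphism g : zmod_morphism (act g).
Proof. by move=> a b; apply: bfun_ext. Qed.
Lemma act_is_monoid_morphism g : monoid_morphism (act g).
Proof. by split=> [|a b]; apply: bfun_ext. Qed.
HB.instance Definition _ g := GRing.isZmodMorphism.Build _ _ (act g) (act_is_zmod_morphism g).
HB.instance Definition _ g :=
  GRing.isMonoidMorphism.Build _ _ (act g) (act_is_monoid_morphism g).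

Lemma act0 a : act 0 a = a.
Proof. by apply: bfun_ext => x; rewrite actE; case: Hact => _ _ -> _. Qed.

Lemma actD g h a : act (g + h) a = act g (act h a).
(* Composition reverses the order of [g] and [h]; commutativity of [G] restores it. *)
Proof. by apply: bfun_ext => x; rewrite addrC !actE; case: Hact => _ _ _ ->. Qed.

Lemma act_cb g c : act g (cb c) = cb c.
Proof. exact: bfun_ext. Qed.

Lemma EE_act g a : EE (act g a) = EE a.
Proof.
apply: EFin_inj; rewrite -!EE_fin.
rewrite -[LHS](@integral_pushforward _ _ _ _ _ (T g) (act_measurable g) P setT (EFin \o a)) //.
- apply: eq_measure_integral; first exact: act_measurable.
  by move=> mT A mA _; rewrite /= /pushforward; case: Hact => _ ->.
- by apply/measurable_EFinP; exact: bfun_measurable.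
- by rewrite preimage_setT; exact: (bfun_integrable P (act g a)).
Qed.

End Action.

(** * Ergodicity: invariant functions are constant almost everywhere *)

Section Ergodic.
Variables (G : zmodType) (d : measure_display) (X : measurableType d) (R : realType).
Variables (P : probability X R) (T : G -> X -> X).
Hypothesis Hact : mp_action P T.
Hypothesis Herg : ergodic_action P T.
Hypothesis Gcount : countable [set: G].
Notation V := (bfun X R).
Notation EE := (EE P).
Notation act := (act Hact).
Implicit Types a b c : V.

Lemma ae_forall_countable (Q : G -> set X) :
  (forall g, \forall x \ae P, Q g x) -> \forall x \ae P, forall g, Q g x.
Proof.
move=> aeQ; have /countable_injP[f finj] := Gcount.
have : \forall x \ae P, forall n g, f g = n -> Q g x.
  apply: ae_foralln => n.
  have [[g fg]|nofg] := pselect (exists g, f g = n); last first.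
    by apply: aeW => x g fg; case: nofg; exists g.
  apply: filterS (aeQ g) => x Qx g'; rewrite -fg => fgg.
  by rewrite (finj g' g) ?inE.
by apply: filterS => x Qx g; exact: (Qx (f g)).
Qed.

Lemma countable_exists_measurable (Q : G -> set X) :
  (forall g, measurable (Q g)) -> measurable [set x | exists g, Q g x].
Proof.
move=> mQ; have /countable_injP[f finj] := Gcount.
rewrite (_ : [set x | _] = \bigcup_n [set x | exists2 g, f g = n & Q g x]).
  apply: bigcupT_measurable => n.
  have [[g fg]|nofg] := pselect (exists g, f g = n).
    rewrite (_ : [set x | _] = Q g) //; apply/seteqP; split=> x /=.
      by move=> [g']; rewrite -fg => /finj ->; rewrite ?inE.
    by exists g.
  rewrite (_ : [set x | _] = set0) //; apply/seteqP; split=> x //= -[g fg].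
  by case: nofg; exists g.
apply/seteqP; split=> x /= [].
  by move=> g Qx; exists (f g) => //; exists g.
by move=> n _ [g _ Qx]; exists g.
Qed.

(** The set where [c] exceeds its mean is invariant up to null sets, hence null or conull, so
    [c - EE c] has constant sign almost everywhere; its integral being 0, it vanishes almost
    everywhere. *)
Lemma ergodic_invariant_cst c :
  (forall g, EE ((act g c - c) * (act g c - c)) = 0) ->
  EE ((c - cb (EE c)) * (c - cb (EE c))) = 0.
Proof.
move=> cinv; set b := EE c.
have cae : \forall x \ae P, forall g, c (T g x) = c x.
  apply: ae_forall_countable => g.
  have /EE_eq0_ae := cinv g; move=> /(_ (fun x => sqr_ge0 (act g c x - c x))).
  apply: filterS => x; by move/eqP; rewrite bfunM mulf_eq0 orbb bfunD bfunN actE subr_eq0 => /eqP.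
(* Quantifying over the orbit makes [D] exactly invariant, as [ergodic_action] asks, although [c] is
   invariant only almost everywhere. *)
pose D := [set x | exists g, b < c (T g x)].
have mD : measurable D.
  apply: countable_exists_measurable => g.
  have := @measurable_fun_ltr _ _ _ setT (cst b) (act g c) (measurable_cst _)
    (bfun_measurable _) measurableT [set true] I.
  by rewrite setTI; congr measurable; apply/seteqP; split=> x /=; case: (_ < _).
have Dinv h : T h @^-1` D = D.
  have TD g g' x : T g (T g' x) = T (g + g') x by case: Hact => _ _ _ ->.
  apply/seteqP; split=> x [g]; rewrite ?TD => bc.
    by exists (g + h).
  by exists (g - h); rewrite TD subrK.
have E0 : EE (c - cb b) = 0 by rewrite raddfB /= EE_cst subrr.
have Enorm : EE (bnorm (c - cb b)) = 0.
  have [PD|PD] := Herg mD Dinv.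
    suff : EE (bnorm (c - cb b) + (c - cb b)) = 0 by rewrite raddfD /= E0 addr0.
    apply: EE_ae0; exists D; split=> // x; apply: contra_notP => nDx.
    change ((bnorm (c - cb b) + (c - cb b)) x = 0).
    rewrite bfunD /= ler0_norm ?addNr// subr_le0 leNgt.
    apply/negP => bc; apply: nDx; exists 0.
    by case: Hact => _ _ -> _.
  suff : EE (bnorm (c - cb b) - (c - cb b)) = 0 by rewrite raddfB /= E0 subr0.
  have aeD : \forall x \ae P, D x.
    exists (~` D); split=> //; first exact: measurableC.
    by rewrite probability_setC // PD subee.
  apply: EE_ae0; apply: filterS2 cae aeD => x cx [g]; rewrite cx => bc.
  by rewrite bfunD bfunN /= ger0_norm ?subrr // subr_ge0 ltW.
apply: EE_ae0; have := EE_eq0_ae _ Enorm.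
move=> /(_ (fun=> normr_ge0 _)); apply: filterS => x cx0.
have {}cx0 : (c - cb b) x = 0 by apply/eqP; rewrite -normr_eq0; apply/eqP.
by rewrite bfunM cx0 mulr0.
Qed.

End Ergodic.

(** * The L^2 inner product and vector averages *)

Section InnerProduct.
Variables (d : measure_display) (X : measurableType d) (R : realType).
Variable P : probability X R.
Notation V := (bfun X R).
Notation EE := (EE P).
Implicit Types a b c : V.

Definition ip a b := EE (a * b).
Definition nrm a := Num.sqrt (ip a a).

Lemma ipC a b : ip a b = ip b a. Proof. by rewrite /ip mulrC. Qed.
Lemma ipDl a b c : ip (a + b) c = ip a c + ip b c.
Proof. by rewrite /ip mulrDl raddfD. Qed.
Lemma ipDr a b c : ip a (b + c) = ip a b + ip a c.
Proof. by rewrite /ip mulrDr raddfD. Qed.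
Lemma ipBl a b c : ip (a - b) c = ip a c - ip b c.
Proof. by rewrite /ip mulrBl raddfB. Qed.
Lemma ipBr a b c : ip a (b - c) = ip a b - ip a c.
Proof. by rewrite /ip mulrBr raddfB. Qed.
Lemma ipZl r a b : ip (cb r * a) b = r * ip a b.
Proof. by rewrite /ip -mulrA EEZ. Qed.
Lemma ipZr r a b : ip a (cb r * b) = r * ip a b.
Proof. by rewrite ipC ipZl ipC. Qed.
Lemma ip_suml (I : Type) (s : seq I) (v : I -> V) b :
  ip (\sum_(i <- s) v i) b = \sum_(i <- s) ip (v i) b.
Proof. by rewrite /ip mulr_suml raddf_sum. Qed.
Lemma ip_sumr (I : Type) (s : seq I) (v : I -> V) b :
  ip b (\sum_(i <- s) v i) = \sum_(i <- s) ip b (v i).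
Proof. by rewrite ipC ip_suml; apply: eq_bigr => i _; rewrite ipC. Qed.

Lemma ip_ge0 a : 0 <= ip a a.
Proof. by apply: EE_ge0 => x; rewrite bfunM -expr2 sqr_ge0. Qed.

Lemma nrm_ge0 a : 0 <= nrm a. Proof. exact: sqrtr_ge0. Qed.
Hint Resolve nrm_ge0 : core.

Lemma nrm_sq a : nrm a ^+ 2 = ip a a. Proof. by rewrite sqr_sqrtr ?ip_ge0. Qed.

Lemma nrm_le a r : 0 <= r -> (nrm a <= r) = (ip a a <= r ^+ 2).
Proof. by move=> r0; rewrite -nrm_sq ler_pXn2r ?nnegrE. Qed.

Lemma nrm0 : nrm 0 = 0. Proof. by rewrite /nrm /ip mul0r raddf0 sqrtr0. Qed.
Lemma nrmN a : nrm (- a) = nrm a. Proof. by rewrite /nrm /ip mulrNN. Qed.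
Lemma nrmC a b : nrm (a - b) = nrm (b - a). Proof. by rewrite -opprB nrmN. Qed.

Lemma ip_sq_le a b : ip a b ^+ 2 <= ip a a * ip b b.
Proof.
have H t : 0 <= ip a a - 2 * t * ip a b + t ^+ 2 * ip b b.
  have := ip_ge0 (a - cb t * b).
  by rewrite ipBl !ipBr !ipZl !ipZr (ipC b a); lra.
have [b0|b0] := eqVneq (ip b b) 0.
  have [->|ab0] := eqVneq (ip a b) 0; first by rewrite b0 mulr0 expr0n.
  (* When [ip b b] is 0 the quadratic is affine in [t], and this [t] gives it the value -1. *)
  have := H ((ip a a + 1) / (2 * ip a b)); rewrite b0 mulr0 addr0.
  have -> : 2 * ((ip a a + 1) / (2 * ip a b)) * ip a b = ip a a + 1 by field.
  by have := ip_ge0 a; lra.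
have bp : 0 < ip b b by rewrite lt_neqAle eq_sym b0 ip_ge0.
have := H (ip a b / ip b b).
have -> : ip a a - 2 * (ip a b / ip b b) * ip a b + (ip a b / ip b b) ^+ 2 * ip b b
  = (ip a a * ip b b - ip a b ^+ 2) / ip b b by field.
by rewrite pmulr_lge0 ?invr_gt0// subr_ge0.
Qed.

Lemma ip_le a b : `|ip a b| <= nrm a * nrm b.
Proof.
rewrite -(ler_pXn2r (n := 2)) ?nnegrE ?mulr_ge0//.
by rewrite exprMn !nrm_sq real_normK ?num_real// ip_sq_le.
Qed.

Lemma nrmD a b : nrm (a + b) <= nrm a + nrm b.
Proof.
rewrite nrm_le ?addr_ge0// ipDl !ipDr (ipC b a) sqrrD !nrm_sq.
have := ip_le a b; rewrite ler_norml => /andP[_]; lra.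
Qed.

Lemma nrm_tri b a c : nrm (a - c) <= nrm (a - b) + nrm (b - c).
Proof. have -> : a - c = (a - b) + (b - c) by ring.
exact: nrmD. Qed.

Lemma nrmZ r a : nrm (cb r * a) = `|r| * nrm a.
Proof. by rewrite /nrm ipZl ipZr mulrA -expr2 sqrtrM ?sqr_ge0// sqrtr_sqr. Qed.

Lemma ler_nrm a b : (forall x, `|a x| <= `|b x|) -> nrm a <= nrm b.
Proof.
move=> ab; rewrite ler_wsqrtr//; apply: ler_EE => x.
rewrite !bfunM -!expr2 -[leLHS]real_normK ?num_real// -[leRHS]real_normK ?num_real//.
by rewrite ler_pXn2r ?nnegrE.
Qed.

Lemma nrm_mul_le (M : R) a b : (forall x, `|a x| <= M) -> nrm (a * b) <= M * nrm b.
Proof.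
move=> aM; have M0 : 0 <= M by exact: le_trans (aM point).
rewrite -{1}(ger0_norm M0) -nrmZ; apply: ler_nrm => x.
by rewrite !bfunM !normrM cbE (ger0_norm M0) ler_wpM2r.
Qed.

Lemma nrm1 : nrm 1 = 1. Proof. by rewrite /nrm /ip mulr1 EE1 sqrtr1. Qed.

Lemma nrm_bound M a : (forall x, `|a x| <= M) -> nrm a <= M.
Proof. by move=> /nrm_mul_le => /(_ 1); rewrite nrm1 !mulr1. Qed.

Lemma EE_le_nrm a : `|EE a| <= nrm a.
Proof. by have := ip_le a 1; rewrite nrm1 mulr1 /ip mulr1. Qed.

Lemma nrm_complete (f_ : nat -> V) (M : R) :
  (forall n x, `|f_ n x| <= M) ->
  (forall n k, nrm (f_ n - f_ (n + k)%N) <= 2^-1 ^+ n) ->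
  exists f : V, (forall x, `|f x| <= M) /\ forall n, nrm (f_ n - f) <= 2^-1 ^+ n.
Proof.
have h0 n : 0 <= 2^-1 ^+ n :> R by rewrite exprn_ge0// invr_ge0.
have h2 n : (2^-1 ^+ n) ^+ 2 = 4^-1 ^+ n :> R.
  by rewrite -exprM mulnC exprM; congr (_ ^+ _); rewrite expr2; lra.
move=> fM fC; have [n k|f [fb fn]] := bfun_complete (P := P) fM.
  by have := fC n k; rewrite nrm_le // h2.
by exists f; split=> // n; rewrite nrm_le // h2; exact: fn.
Qed.

(* The Gram form of the tensors [a i (x) b i] in L^2(P x P), computed by iterated
   integration so that the product space is not needed. *)
Lemma tensor_gram_ge0 (I : Type) (s : seq I) (a b : I -> V) :
  0 <= \sum_(i <- s) \sum_(j <- s) ip (a i) (a j) * ip (b i) (b j).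
Proof.
pose c : V := \sum_(i <- s) \sum_(j <- s) cb (ip (b i) (b j)) * (a i * a j).
have -> : \sum_(i <- s) \sum_(j <- s) ip (a i) (a j) * ip (b i) (b j) = EE c.
  rewrite raddf_sum; apply: eq_bigr => i _; rewrite raddf_sum.
  by apply: eq_bigr => j _ /=; rewrite EEZ mulrC.
apply: EE_ge0 => x.
suff -> : c x = ip (\sum_(i <- s) cb (a i x) * b i) (\sum_(i <- s) cb (a i x) * b i).
  exact: ip_ge0.
rewrite ip_suml bfun_sum; apply: eq_bigr => i _; rewrite ip_sumr bfun_sum.
by apply: eq_bigr => j _; rewrite !bfunM cbE ipZl ipZr; ring.
Qed.

Section VectorAverage.
Variable I : Type.
Implicit Types (s : seq I) (v w : I -> V).

Definition vavg s v : V := cb (size s)%:R^-1 * \sum_(i <- s) v i.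

Lemma ip_vavgl s v b : ip (vavg s v) b = avg s (fun i => ip (v i) b).
Proof. by rewrite /vavg ipZl ip_suml. Qed.

Lemma EE_vavg s v : EE (vavg s v) = avg s (fun i => EE (v i)).
Proof. by rewrite /vavg EEZ raddf_sum. Qed.

Lemma vavgE s v x : vavg s v x = avg s (fun i => v i x).
Proof. by rewrite /vavg bfunM bfun_sum. Qed.

Lemma vavgB s v w : vavg s v - vavg s w = vavg s (fun i => v i - w i).
Proof. by rewrite /vavg sumrB mulrBr. Qed.

Lemma eq_vavg s v w : v =1 w -> vavg s v = vavg s w.
Proof. by move=> vw; rewrite /vavg; congr (_ * _); apply: eq_bigr. Qed.

Lemma vavg_cst s a : s <> [::] -> vavg s (fun=> a) = a.
Proof. by move=> s0; apply: bfun_ext => x; rewrite vavgE avg_cst. Qed.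

Lemma nrm_vavg_le s v : nrm (vavg s v) <= avg s (fun i => nrm (v i)).
Proof.
rewrite /vavg nrmZ ger0_norm ?invr_ge0// /avg ler_wpM2l ?invr_ge0//.
elim: s => [|i s IHs]; first by rewrite !big_nil nrm0.
by rewrite !big_cons (le_trans (nrmD _ _))// lerD2l.
Qed.

Lemma nrm_vavgB_le s v b r : s <> [::] -> (forall i, nrm (v i - b) <= r) ->
  nrm (vavg s v - b) <= r.
Proof.
move=> s0 vb; rewrite -{1}(vavg_cst b s0) vavgB (le_trans (nrm_vavg_le _ _))//.
by rewrite -(avg_cst r s0); exact: ler_avg.
Qed.

Lemma vavg_bound s v M : s <> [::] -> (forall i x, `|v i x| <= M) ->
  forall x, `|vavg s v x| <= M.
Proof. by move=> s0 vM x; rewrite vavgE; exact: avg_norm_le. Qed.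

End VectorAverage.

Lemma vavg_map (I J : Type) (f : I -> J) (s : seq I) (v : J -> V) :
  vavg (map f s) v = vavg s (fun i => v (f i)).
Proof. by rewrite /vavg size_map big_map. Qed.

Lemma exchange_vavg (I J : Type) (s : seq I) (t : seq J) (v : I -> J -> V) :
  vavg s (fun i => vavg t (v i)) = vavg t (fun j => vavg s (v ^~ j)).
Proof. by apply: bfun_ext => x; rewrite !vavgE;
  under eq_avg do rewrite vavgE; rewrite exchange_avg; apply: eq_avg => j; rewrite vavgE. Qed.

End InnerProduct.
#[global] Hint Extern 0 (is_true (@Order.le _ _ _ (nrm _ _))) => exact: nrm_ge0 : core.

(** * Near-invariant averages for a positive shift-invariant kernel: a Gram kernel, or its square *)

Definition translate (G : zmodType) (g : G) (s : seq G) := [seq x + g | x <- s].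

Section NearInvariantAverages.
Variables (G : zmodType) (R : realType).
Implicit Types s t : seq G.

Variable K : G -> G -> R.
Hypothesis Ksym : forall g h, K g h = K h g.
Hypothesis Kinv : forall k g h, K (g + k) (h + k) = K g h.

Let cross s t := avg s (fun g => avg t (K g)).
Hypothesis Kpos : forall s, 0 <= avg s (fun g => avg s (K g)).

(* Parallelogram identity at a near-minimizer of the norm: the midpoint of the averages
   over [s] and [translate g s] is again an average, over the concatenation. *)
Lemma near_minimizer (e : R) : 0 < e -> exists2 s, s <> [::] &
  forall g, 2 * cross s s - 2 * cross s (translate g s) <= e.
Proof.
move=> e0.
pose S := [set cross s s | s in [set s | s <> [::]]].
have Slb : has_lbound S by exists 0 => _ [s _ <-]; exact: Kpos.
have Sinf : has_inf S by split=> //; exists (cross [:: 0] [:: 0]), [:: 0].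
(* The midpoint has value half of [cross s s + cross s (translate g s)]; it is at least the infimum,
   hence above [cross s s - e / 4]. Multiplying by 4 gives the bound [e]. *)
have e4 : 0 < e / 4 by rewrite divr_gt0.
have [_ [s /= s0 <-] slt] := inf_adherent e4 Sinf.
exists s => // g.
have ss : s ++ translate g s <> [::] by case: s s0 {slt}.
have := ge_inf Slb (ex_intro2 _ _ (s ++ translate g s) ss erefl).
have szp : (size s)%:R != 0 :> R by rewrite gt_eqF// size_gt0R.
have crossE : cross (s ++ translate g s) (s ++ translate g s) =
    2^-1 * cross s s + 2^-1 * cross s (translate g s).
  have hsum (u : G -> R) : avg (s ++ translate g s) u = 2^-1 * (avg s u + avg (translate g s) u).
    rewrite /avg size_cat size_map big_cat /= natrD; field.
    by rewrite szp -mulr2n mulrn_eq0.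
  have c2 : cross (translate g s) s = cross s (translate g s).
    by rewrite /cross exchange_avg; apply: eq_avg => x; apply: eq_avg => y.
  have c3 : cross (translate g s) (translate g s) = cross s s.
    rewrite /cross avg_map; apply: eq_avg => x; rewrite avg_map.
    by apply: eq_avg => y.
  have hc t : cross t (s ++ translate g s) = 2^-1 * (cross t s + cross t (translate g s)).
    by rewrite /cross -avgD -avgZ; apply: eq_avg => x; rewrite hsum.
  by rewrite {1}/cross hsum -/(cross s _) -/(cross (translate g s) _) !hc c2 c3; field.
rewrite crossE; lra.
Qed.

End NearInvariantAverages.

(** * Limits of near-invariant averages *)

Section UniformLimit.
Variables (d : measure_display) (X : measurableType d) (R : realType).
Variables (P : probability X R) (G : zmodType).
Notation V := (bfun X R).
Notation nrm := (nrm P).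

Lemma nrm_vavg_shift_sum (v : G -> V) (s t : seq G) e : t <> [::] ->
  (forall g, nrm (vavg s v - vavg (translate g s) v) <= e) ->
  nrm (vavg s v - vavg t (fun g => vavg (translate g s) v)) <= e.
Proof.
move=> t0 H; rewrite nrmC; apply: nrm_vavgB_le => // g.
by rewrite nrmC.
Qed.

Lemma exists_half_lt (e : R) : 0 < e -> exists n, 2^-1 ^+ n < e.
Proof.
move=> e0; have [n en] : exists n, e^-1 < n%:R.
  by exists (Num.truncn e^-1).+1; have /truncn_itv/andP[] : 0 <= e^-1 by rewrite invr_ge0 ltW.
exists n; rewrite exprVn -[ltRHS]invrK ltf_pV2 ?posrE ?invr_gt0 ?exprn_gt0//.
apply: lt_le_trans en _; rewrite -natrX ler_nat; exact: (ltnW (ltn_expl n _)).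
Qed.

(** Near-invariant averages over [s] and over [t] are both close to the average over their sumset,
    hence to each other. They are therefore Cauchy, with a limit that does not depend on the
    lists. *)
Lemma uniform_limit (v : G -> V) (M : R) : (forall g x, `|v g x| <= M) ->
  (forall e, 0 < e -> exists2 s, s <> [::] &
     forall g, nrm (vavg s v - vavg (translate g s) v) <= e) ->
  exists c : V, (forall x, `|c x| <= M) /\
    forall e s, 0 < e -> s <> [::] ->
      (forall g, nrm (vavg s v - vavg (translate g s) v) <= e) -> nrm (vavg s v - c) <= 2 * e.
Proof.
move=> vM vI.
have sw s t : vavg t (fun g => vavg (translate g s) v) = vavg s (fun g => vavg (translate g t) v).
  rewrite (@eq_vavg _ _ _ _ _ _ (fun g => vavg s (fun h => v (h + g)))).
    rewrite exchange_vavg; apply: eq_vavg => h; rewrite vavg_map.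
    by apply: eq_vavg => g; rewrite addrC.
  by move=> g; rewrite vavg_map.
have close s t e e' : s <> [::] -> t <> [::] ->
    (forall g, nrm (vavg s v - vavg (translate g s) v) <= e) ->
    (forall g, nrm (vavg t v - vavg (translate g t) v) <= e') ->
    nrm (vavg s v - vavg t v) <= e + e'.
  move=> s0 t0 se te; apply: le_trans (nrm_tri P (vavg t (fun g => vavg (translate g s) v)) _ _) _.
  apply: lerD; first exact: nrm_vavg_shift_sum.
  by rewrite nrmC sw; exact: nrm_vavg_shift_sum.
(* Halving makes the errors at [n] and [n + k] add up to at most [2^-1 ^+ n], the rate asked by
   [nrm_complete]. *)
have h0 n : 0 < 2^-1 ^+ n / 2 :> R by rewrite divr_gt0// exprn_gt0// invr_gt0.
have /choice[S HS] n : exists s, s <> [::] /\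
    forall g, nrm (vavg s v - vavg (translate g s) v) <= 2^-1 ^+ n / 2.
  by have [s ? ?] := vI _ (h0 n); exists s.
have [||c [cM cl]] := @nrm_complete _ X R P (fun n => vavg (S n) v) M.
- by move=> n; apply: vavg_bound => //; case: (HS n).
- move=> n k; have [Sn0 Sn] := HS n; have [Sk0 Sk] := HS (n + k)%N.
  apply: le_trans (close _ _ _ _ Sn0 Sk0 Sn Sk) _.
  have : 2^-1 ^+ (n + k) <= 2^-1 ^+ n :> R.
    by rewrite exprD ler_piMr ?exprn_ge0 ?invr_ge0// exprn_ile1 ?invr_ge0//; lra.
  lra.
exists c; split=> // e s e0 s0 se.
have e2 : 0 < e / 2 by rewrite divr_gt0.
have [n ne] := exists_half_lt e2.
have [Sn0 Sn] := HS n.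
have := nrm_tri P (vavg (S n) v) (vavg s v) c.
have := close _ _ _ _ s0 Sn0 se Sn; have := cl n; lra.
Qed.

End UniformLimit.

(** * Uniform means and finite-index subgroups *)

Section UniformMean.
Variables (G : zmodType) (R : realType).
Implicit Types w : G -> R.

(** Uniformity in [k] allows the averages to be read at the points [theta g - c] of a coset in
    [mean_finite_index]. *)
Definition uniform_mean w (l : R) := forall e : R, 0 < e -> exists2 s : seq G, s <> [::] &
  forall k, `|avg s (fun g => w (k + g)) - l| <= e.

Lemma umean0 : uniform_mean (fun=> 0) 0.
Proof. by move=> e e0; exists [:: 0] => // k; rewrite avg_cst// subr0 normr0 ltW. Qed.

(** The sumset of the two lists serves both functions: a further averaging keeps any bound that is
    uniform in [k]. *)
Lemma umeanD w w' l l' : uniform_mean w l -> uniform_mean w' l' ->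
  uniform_mean (fun g => w g + w' g) (l + l').
Proof.
move=> wl wl' e e0; have e2 : 0 < e / 2 by rewrite divr_gt0.
have [s s0 sl] := wl _ e2; have [t t0 tl] := wl' _ e2.
have far u r (x y : seq G) : x <> [::] -> y <> [::] ->
    (forall k, `|avg x (fun g => u (k + g)) - r| <= e / 2) ->
    forall k, `|avg y (fun h => avg x (fun g => u (k + h + g))) - r| <= e / 2.
  move=> x0 y0 xu k; rewrite -(avg_cst r y0) -avgB; exact: avg_norm_le.
exists [seq a + b | a <- s, b <- t]; first by case: s s0 {sl} => // a s _; case: t t0 {tl}.
move=> k; rewrite avg_allpairs.
have -> : avg s (fun a => avg t (fun b => w (k + (a + b)) + w' (k + (a + b)))) =
    avg t (fun b => avg s (fun a => w (k + b + a))) +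
    avg s (fun a => avg t (fun b => w' (k + a + b))).
  rewrite -[X in X + _]exchange_avg -avgD; apply: eq_avg => a; rewrite -avgD.
  by apply: eq_avg => b; rewrite [k + b + a]addrAC addrA.
have := far _ _ _ _ s0 t0 sl k; have := far _ _ _ _ t0 s0 tl k.
by rewrite !ler_norml => /andP[? ?] /andP[? ?]; apply/andP; split; lra.
Qed.

Lemma umean_sum (J : Type) (s : seq J) (w : J -> G -> R) (l : J -> R) :
  (forall j, uniform_mean (w j) (l j)) ->
  uniform_mean (fun g => \sum_(j <- s) w j g) (\sum_(j <- s) l j).
Proof.
move=> wl; elim: s => [|j s IHs].
  by under eq_fun do rewrite big_nil; rewrite big_nil; exact: umean0.
by under eq_fun do rewrite big_cons; rewrite big_cons; exact: (umeanD (wl j) IHs).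
Qed.

Variable m : (G -> R) -> R.
Hypothesis hm : invariant_mean m.

Lemma mean_avg (J : Type) (s : seq J) (u : J -> G -> R) : (forall j, bddf (u j)) ->
  m (fun g => avg s (u ^~ g)) = avg s (fun j => m (u j)).
Proof.
by move=> bu; rewrite /avg (meanZ hm) ?(mean_sum hm)//; exact: bddf_sum.
Qed.

(** For every [x] some representative [c] puts [x - c] in the range of [theta], and shift invariance
    then identifies the mean of [w (theta g - c + x)] with that of [w (theta g)]. Since [w] is
    nonnegative, all [c] may be summed; averaging over [x] bounds each summand by nearly [l]. *)
Lemma mean_finite_index w l (theta : G -> G) (cs : seq G) :
  {morph theta : g h / g + h} ->
  (forall x, exists2 c, c \in cs & range theta (x - c)) ->
  bddf w -> (forall g, 0 <= w g) -> uniform_mean w l ->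
  m (fun g => w (theta g)) <= (size cs)%:R * l.
Proof.
move=> thD csP bw w0 wl.
have bc f : bddf (fun g : G => w (f g)) by exact: bddf_comp.
have H (e : R) : 0 < e -> m (fun g => w (theta g)) <= (size cs)%:R * (l + e).
  move=> e0; have [s s0 sl] := wl e e0.
  have -> : m (fun g => w (theta g)) = avg s (fun=> m (fun g => w (theta g))).
    by rewrite avg_cst.
  apply: (@le_trans _ _ (avg s (fun x => \sum_(c <- cs) m (fun g => w (theta g - c + x))))).
    apply: ler_avg => x; have [c ccs [y _ yx]] := csP x.
    rewrite (big_rem c) //=.
    have -> : m (fun g => w (theta g - c + x)) = m (fun g => w (theta g)).
      rewrite -(mean_shift hm y (bc theta)); congr m; apply/funext => g.
      by rewrite thD yx addrAC addrA.
    rewrite lerDl; apply: sumr_ge0 => i _; apply: (mean_ge0 hm) => //.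
  have -> : avg s (fun x => \sum_(c <- cs) m (fun g => w (theta g - c + x))) =
      \sum_(c <- cs) m (fun g => avg s (fun x => w (theta g - c + x))).
    rewrite /avg mulr_sumr; under eq_bigr do rewrite mulr_sumr.
    rewrite exchange_big /=; apply: eq_bigr => c _.
    by rewrite -mulr_sumr -/(avg s _) -mean_avg.
  have -> : (size cs)%:R * (l + e) = \sum_(c <- cs) (l + e).
    by rewrite big_const_seq count_predT iter_addr_0 mulr_natl.
  apply: ler_sum => c _; rewrite -[leRHS](mean_cst hm); apply: (ler_mean hm).
  - by rewrite /avg; apply: bddfM; [exact: bddf_cst|exact: bddf_sum].
  - exact: bddf_cst.
  - by move=> g; have := sl (theta g - c); rewrite ler_norml => /andP[_]; lra.
rewrite leNgt; apply/negP => lt.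
pose N : R := (size cs)%:R; have N0 : 0 <= N by rewrite ler0n.
(* With this error, [N * e] stays strictly below the gap between the mean and [N * l], also when [N]
   is 0. *)
have e0 : 0 < (m (fun g => w (theta g)) - N * l) / (N + 1).
  by rewrite divr_gt0 ?subr_gt0// ltr_wpDl.
have := H _ e0; rewrite -/N.
set r := m _ in lt e0 *; have z0 : 0 < r - N * l by rewrite subr_gt0.
have -> : r = (r - N * l) + N * l by rewrite subrK.
move: z0; set z := r - N * l => z0.
rewrite mulrDr addrC lerD2l mulrA ler_pdivlMr ?ltr_wpDl//; nra.
Qed.

End UniformMean.

(** * The mean ergodic theorem *)

Section MeanErgodic.
Variables (G : zmodType) (d : measure_display) (X : measurableType d) (R : realType).
Variables (P : probability X R) (T : G -> X -> X).
Hypothesis Hact : mp_action P T.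
Notation V := (bfun X R).
Notation EE := (EE P).
Notation ip := (ip P).
Notation nrm := (nrm P).
Notation act := (act Hact).
Implicit Types a b c : V.

Lemma ip_act g a b : ip (act g a) (act g b) = ip a b.
Proof. by rewrite /ip -rmorphM EE_act. Qed.

Lemma ip_actl g a b : ip (act g a) b = ip a (act (- g) b).
Proof. by rewrite -(ip_act (- g)) -actD addNr act0. Qed.

Lemma nrm_act g a : nrm (act g a) = nrm a.
Proof. by rewrite /nrm ip_act. Qed.

Lemma act_vavg (I : Type) g (s : seq I) (v : I -> V) :
  act g (vavg s v) = vavg s (fun i => act g (v i)).
Proof. by apply: bfun_ext => x; rewrite actE !vavgE. Qed.

Lemma ip_vavg (I J : Type) (s : seq I) (t : seq J) (v : I -> V) (w : J -> V) :
  ip (vavg s v) (vavg t w) = avg s (fun i => avg t (fun j => ip (v i) (w j))).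
Proof.
rewrite ip_vavgl; apply: eq_avg => i; rewrite ipC ip_vavgl.
by apply: eq_avg => j; rewrite ipC.
Qed.

(** For the Gram kernel of the orbit, the quantity bounded in [near_minimizer] is the squared
    distance between the two averages. *)
Lemma act_near_invariant b (e : R) : 0 < e -> exists2 s : seq G, s <> [::] &
  forall g, nrm (vavg s (act ^~ b) - vavg (translate g s) (act ^~ b)) <= e.
Proof.
move=> e0; pose K g h := ip (act g b) (act h b).
have Ksym g h : K g h = K h g by rewrite /K ipC.
have Kinv k g h : K (g + k) (h + k) = K g h.
  by rewrite /K ![_ + k]addrC !actD ip_act.
have Kpos s : 0 <= avg s (fun g => avg s (K g)) by rewrite -ip_vavg; exact: ip_ge0.
have [s s0 sK] := near_minimizer Ksym Kinv Kpos (exprn_gt0 2 e0).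
exists s => // g; rewrite nrm_le ?(ltW e0)// ipBl !ipBr.
have -> : ip (vavg (translate g s) (act ^~ b)) (vavg (translate g s) (act ^~ b)) =
    ip (vavg s (act ^~ b)) (vavg s (act ^~ b)).
  rewrite -[RHS](ip_act g) !act_vavg; congr ip; rewrite vavg_map;
  by apply: eq_vavg => h; rewrite addrC actD.
rewrite (ipC P (vavg (translate g s) _)) !ip_vavg.
have := sK g; rewrite /K; lra.
Qed.

Lemma bfun_orbit_bound b : exists M, forall g x, `|act g b x| <= M.
Proof. by have [M bM] := bfun_bdd b; exists M => g x; rewrite actE. Qed.

Hypothesis Herg : ergodic_action P T.
Hypothesis Gcount : countable [set: G].

(** The limit of near-invariant averages is invariant, so ergodicity makes it constant; its integral
    is that of [b]. *)
Lemma mean_ergodic b (e : R) : 0 < e -> exists2 s : seq G, s <> [::] &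
  forall g, nrm (vavg (translate g s) (act ^~ b) - cb (EE b)) <= e.
Proof.
move=> e0; have [M bM] := bfun_orbit_bound b.
have [c [_ cl]] := uniform_limit bM (act_near_invariant b).
have vshift k s : vavg (translate k s) (act ^~ b) = act k (vavg s (act ^~ b)).
  by rewrite vavg_map act_vavg; apply: eq_vavg => h; rewrite addrC actD.
have cinv k : nrm (act k c - c) = 0.
  apply/eqP; rewrite eq_le nrm_ge0 andbT leNgt; apply/negP => lt.
  (* With [delta] this tenth, [c] and [act k c] lie within [2 delta] of averages that are [delta]
     apart, so their distance would be at most [5 delta], half of itself. *)
  have lt5 : 0 < nrm (act k c - c) / 10 by rewrite divr_gt0.
  have [s s0 sI] := act_near_invariant b lt5.
  have sc := cl _ _ lt5 s0 sI.
  have := nrm_tri P (vavg (translate k s) (act ^~ b)) (act k c) c.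
  have := nrm_tri P (vavg s (act ^~ b)) (vavg (translate k s) (act ^~ b)) c.
  have := sI k; rewrite nrmC.
  have : nrm (act k c - vavg (translate k s) (act ^~ b)) = nrm (vavg s (act ^~ b) - c).
    by rewrite vshift -raddfB nrm_act nrmC.
  lra.
have cE : nrm (c - cb (EE c)) = 0.
  rewrite /nrm /ip (ergodic_invariant_cst (Hact := Hact)) ?sqrtr0// => g.
  by rewrite -/(ip _ _) -nrm_sq cinv expr0n.
have e8 : 0 < e / 8 by rewrite divr_gt0.
have EcEb : `|EE c - EE b| <= 0.
  rewrite leNgt; apply/negP => lt.
  have lt5 : 0 < `|EE c - EE b| / 10 by rewrite divr_gt0.
  have [s s0 sI] := act_near_invariant b lt5.
  have sc := cl _ _ lt5 s0 sI.
  have := EE_le_nrm P (vavg s (act ^~ b) - c).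
  rewrite raddfB /= EE_vavg (eq_avg _ (v := fun=> EE b)); last by move=> g; rewrite EE_act.
  rewrite avg_cst // distrC; lra.
move: EcEb; rewrite normr_le0 subr_eq0 => /eqP EcEb.
have [s s0 sI] := act_near_invariant b e8.
have sc := cl _ _ e8 s0 sI.
exists s => // g; rewrite -EcEb.
have := nrm_tri P c (vavg (translate g s) (act ^~ b)) (cb (EE c)).
have := nrm_tri P (vavg s (act ^~ b)) (vavg (translate g s) (act ^~ b)) c.
have := sI g; rewrite nrmC; lra.
Qed.

Lemma umean_ip a b : uniform_mean (fun k => ip a (act k b)) (EE a * EE b).
Proof.
move=> e e0.
have a1 : 0 < nrm a + 1 by rewrite ltr_wpDl.
have e1 : 0 < e / (nrm a + 1) by rewrite divr_gt0.
have [s s0 sI] := mean_ergodic b e1.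
exists s => // k.
have -> : avg s (fun g => ip a (act (k + g) b)) - EE a * EE b =
    ip a (vavg (translate k s) (act ^~ b) - cb (EE b)).
  rewrite ipBr ipC ip_vavgl avg_map; congr (_ - _).
    by apply: eq_avg => g; rewrite ipC addrC.
  by rewrite /ip [a * _]mulrC EEZ mulrC.
apply: le_trans (ip_le _ _ _) _.
apply: (@le_trans _ _ ((nrm a + 1) * (e / (nrm a + 1)))).
  by apply: ler_pM => //; rewrite lerDl.
by rewrite mulrC divfK ?gt_eqF.
Qed.

(* With [F (x, y) = \sum_i a i x * b i y], the left side is the mean of
   \int F (x, T (theta g) x) ^ 2 and the sum on the right is \int \int F ^ 2. *)
Lemma mean_tensor_le (m : (G -> R) -> R) (theta : G -> G) (cs : seq G)
    (I : Type) (s : seq I) (a b : I -> V) :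
  invariant_mean m -> {morph theta : g h / g + h} ->
  (forall x, exists2 c, c \in cs & range theta (x - c)) ->
  m (fun g => EE ((\sum_(i <- s) a i * act (theta g) (b i)) ^+ 2)) <=
    (size cs)%:R * \sum_(i <- s) \sum_(j <- s) ip (a i) (a j) * ip (b i) (b j).
Proof.
move=> hm thD csP.
pose w k := EE ((\sum_(i <- s) a i * act k (b i)) ^+ 2).
have wE : w = fun k => \sum_(i <- s) \sum_(j <- s) ip (a i * a j) (act k (b i * b j)).
  apply/funext => k; rewrite /w expr2 mulr_suml raddf_sum; apply: eq_bigr => i _.
  rewrite mulr_sumr raddf_sum; apply: eq_bigr => j _ /=.
  by rewrite /ip rmorphM; congr EE; ring.
apply: (@mean_finite_index _ _ m hm w) => //.
- rewrite wE; apply: bddf_sum => i; apply: bddf_sum => j.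
  exists (nrm (a i * a j) * nrm (b i * b j)) => g.
  by rewrite -(nrm_act g (b i * b j)); exact: ip_le.
- by move=> g; rewrite /w expr2; exact: ip_ge0.
- rewrite wE; apply: umean_sum => i; apply: umean_sum => j; exact: umean_ip.
Qed.

End MeanErgodic.

(** * Total boundedness *)

Section TotallyBounded.
Variables (R : realType) (T : choiceType) (x0 : T).

(** One representative is taken in each nonempty cell of the common refinement, which keeps the
    centers in [T] itself; empty cells receive the default [x0]. *)
Lemma cover_refine (I J : eqType) (s1 : seq I) (s2 : seq J)
    (Q1 : T -> I -> Prop) (Q2 : T -> J -> Prop) :
  (forall g, exists2 i, i \in s1 & Q1 g i) -> (forall g, exists2 j, j \in s2 & Q2 g j) ->
  exists s : seq T, forall g, exists2 h, h \in s &
    (exists i, Q1 g i /\ Q1 h i) /\ (exists j, Q2 g j /\ Q2 h j).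
Proof.
move=> H1 H2.
have /choice[rep repP] (p : I * J) : exists h, (exists g, Q1 g p.1 /\ Q2 g p.2) ->
    Q1 h p.1 /\ Q2 h p.2.
  have [[g Hg]|ng] := pselect (exists g, Q1 g p.1 /\ Q2 g p.2); first by exists g.
  by exists x0.
exists [seq rep p | p <- [seq (i, j) | i <- s1, j <- s2]] => g.
have [i is1 Qi] := H1 g; have [j js2 Qj] := H2 g.
have [Ri Rj] := repP (i, j) (ex_intro _ g (conj Qi Qj)).
exists (rep (i, j)).
  by apply/map_f/allpairsP; exists (i, j).
by split; [exists i|exists j].
Qed.

Definition totally_bdd (D : T -> T -> R) := forall e : R, 0 < e -> exists s : seq T,
  forall g, exists2 h, h \in s & D g h <= e.

(** Written for a symmetric distance: both points are compared with a common center [k]. *)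
Definition triangular (S : Type) (D : S -> S -> R) := forall g h k, D g h <= D g k + D h k.

Lemma tbd_le (D D' : T -> T -> R) (L : R) : 0 <= L ->
  (forall g h, D' g h <= L * D g h) -> totally_bdd D -> totally_bdd D'.
Proof.
move=> L0 DD tD e e0; have L1 : 0 < L + 1 by rewrite ltr_wpDl.
have [s sD] := tD (e / (L + 1)) (divr_gt0 e0 L1).
exists s => g; have [h hs Dgh] := sD g; exists h => //.
apply: le_trans (DD _ _) _.
apply: (@le_trans _ _ (L * (e / (L + 1)))); first by rewrite ler_wpM2l.
by rewrite mulrCA ler_piMr ?(ltW e0)// ler_pdivrMr// mul1r lerDl.
Qed.

Lemma tbdD (D1 D2 : T -> T -> R) : triangular D1 -> triangular D2 ->
  totally_bdd D1 -> totally_bdd D2 ->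
  totally_bdd (fun g h => D1 g h + D2 g h).
Proof.
move=> t1 t2 D1t D2t e e0; have e4 : 0 < e / 4 by rewrite divr_gt0.
have [s1 s1P] := D1t _ e4; have [s2 s2P] := D2t _ e4.
have [s sP] := cover_refine s1P s2P.
exists s => g; have [h hs [[i [g1 h1]] [j [g2 h2]]]] := sP g; exists h => //.
have := t1 g h i; have := t2 g h j; lra.
Qed.

Lemma tbd0 : totally_bdd (fun _ _ => 0).
Proof. by move=> e e0; exists [:: x0] => g; exists x0; rewrite ?mem_head// ltW. Qed.

Lemma triD (S : Type) (D1 D2 : S -> S -> R) : triangular D1 -> triangular D2 ->
  triangular (fun g h => D1 g h + D2 g h).
Proof. by move=> t1 t2 g h k; have := t1 g h k; have := t2 g h k; lra. Qed.

Lemma tbd_sum (J : Type) (s : seq J) (D : J -> T -> T -> R) :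
  (forall j, triangular (D j)) -> (forall j, totally_bdd (D j)) ->
  totally_bdd (fun g h => \sum_(j <- s) D j g h).
Proof.
move=> tD bD; suff [] : triangular (fun g h => \sum_(j <- s) D j g h) /\
  totally_bdd (fun g h => \sum_(j <- s) D j g h) by [].
elim: s => [|j s [tI bI]].
  split; first by move=> g h k; rewrite !big_nil addr0.
  have -> : (fun g h => \sum_(j <- [::]) D j g h) = (fun _ _ => 0).
    by apply/funext => g; apply/funext => h; rewrite big_nil.
  exact: tbd0.
have -> : (fun g h => \sum_(j <- j :: s) D j g h) =
    (fun g h => D j g h + \sum_(j <- s) D j g h).
  by apply/funext => g; apply/funext => h; rewrite big_cons.
by split; [exact: triD|exact: tbdD].
Qed.

Lemma tri_dist (u : T -> R) : triangular (fun g h => `|u g - u h|).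
Proof. by move=> g h k; rewrite (distrC (u h)) ler_distD. Qed.

(** The given centers need not be values of [f]; moving them to values of [f] doubles the error. *)
Lemma tbd_comp (S : choiceType) (D : S -> S -> R) (f : T -> S) : triangular D ->
  (forall e, 0 < e -> exists s : seq S, forall g, exists2 h, h \in s & D g h <= e) ->
  totally_bdd (fun g h => D (f g) (f h)).
Proof.
move=> tD bD e e0; have e2 : 0 < e / 2 by rewrite divr_gt0.
have [s1 s1P] := bD _ e2.
have [s sP] := cover_refine (fun g => s1P (f g)) (fun g => s1P (f g)).
exists s => g; have [h hs [[i [g1 h1]] _]] := sP g; exists h => //.
have := tD (f g) (f h) i; lra.
Qed.

Lemma tbd_real (u : T -> R) : bddf u -> totally_bdd (fun g h => `|u g - u h|).
Proof.
move=> [M uM] e e0; have e2 : 0 < e / 2 by rewrite divr_gt0.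
have uM0 g : 0 <= (u g + M) / (e / 2).
  rewrite divr_ge0 ?(ltW e2)//; have := uM g; rewrite ler_norml => /andP[]; lra.
pose q g := Num.truncn ((u g + M) / (e / 2)).
pose N := Num.truncn ((M + M) / (e / 2)).
have qP g : exists2 i, i \in iota 0 N.+1 & q g = i.
  exists (q g) => //; rewrite mem_iota add0n ltnS; apply: le_truncn.
  rewrite ler_pM2r ?invr_gt0// lerD2r.
  by have := uM g; rewrite ler_norml => /andP[].
have [s sP] := cover_refine qP qP.
exists s => g; have [h hs [[i [gi hi]] _]] := sP g; exists h => //.
have /truncn_itv := uM0 g; have /truncn_itv := uM0 h; rewrite -/(q g) -/(q h) gi hi.
rewrite ler_pdivlMr// ltr_pdivrMr// ler_pdivlMr// ltr_pdivrMr// -[i.+1%:R]natr1 ler_norml.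
by move=> /andP[? ?] /andP[? ?]; apply/andP; split; lra.
Qed.

End TotallyBounded.

(** * Almost periodic functions and the projection onto them *)

Section AlmostPeriodic.
Variables (G : zmodType) (d : measure_display) (X : measurableType d) (R : realType).
Variables (P : probability X R) (T : G -> X -> X).
Hypothesis Hact : mp_action P T.
Notation V := (bfun X R).
Notation EE := (EE P).
Notation ip := (ip P).
Notation nrm := (nrm P).
Notation act := (act Hact).
Implicit Types a b c : V.

(** Precompactness of the orbit of [a] in L^2: the functions of the Kronecker factor. *)
Definition almost_periodic a := totally_bdd (fun g h => nrm (act g a - act h a)).

Lemma tri_nrm (I : Type) (v : I -> V) : triangular (fun g h => nrm (v g - v h)).
Proof. by move=> g h k; rewrite (nrmC _ (v h)); exact: nrm_tri. Qed.

Lemma ap_lip2 (L : R) a b c : 0 <= L ->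
  (forall g h, nrm (act g c - act h c) <=
     L * (nrm (act g a - act h a) + nrm (act g b - act h b))) ->
  almost_periodic a -> almost_periodic b -> almost_periodic c.
Proof.
move=> L0 H apa apb; apply: (tbd_le L0 H); apply: (tbdD (0 : G)) => //.
- exact: (tri_nrm (act ^~ a)).
- exact: (tri_nrm (act ^~ b)).
Qed.

Lemma apD a b : almost_periodic a -> almost_periodic b -> almost_periodic (a + b).
Proof.
apply: (@ap_lip2 1) => // g h; rewrite mul1r (raddfD (act g)) (raddfD (act h)) /=.
by rewrite opprD addrACA; exact: nrmD.
Qed.

Lemma apZ r a : almost_periodic a -> almost_periodic (cb r * a).
Proof.
move=> apa; apply: (@ap_lip2 `|r| a a) => // g h.
rewrite !rmorphM /= !act_cb -mulrBr nrmZ ler_wpM2l//.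
by rewrite lerDl.
Qed.

Lemma apM a b : almost_periodic a -> almost_periodic b -> almost_periodic (a * b).
Proof.
have [M aM] := bfun_bdd a; have [N bN] := bfun_bdd b.
have M0 : 0 <= M by exact: le_trans (aM point).
have N0 : 0 <= N by exact: le_trans (bN point).
apply: (@ap_lip2 (M + N)); first exact: addr_ge0.
move=> g h; rewrite !rmorphM /=.
have -> : act g a * act g b - act h a * act h b =
  act g a * (act g b - act h b) + act h b * (act g a - act h a) by ring.
apply: le_trans (nrmD _ _ _) _.
have := @nrm_mul_le _ _ _ P M (act g a) (act g b - act h b) (fun x => aM (T g x)).
have := @nrm_mul_le _ _ _ P N (act h b) (act g a - act h a) (fun x => bN (T h x)).
have := nrm_ge0 P (act g a - act h a); have := nrm_ge0 P (act g b - act h b).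
nra.
Qed.

Lemma clip_contract (r s : R) : `|Num.min 1 (Num.max 0 r) - Num.min 1 (Num.max 0 s)| <= `|r - s|.
Proof.
wlog rs : r s / r <= s => [H|].
  have [/H//|/ltW/H] := leP r s; by rewrite distrC [leRHS]distrC.
rewrite [leRHS]ler0_norm ?subr_le0// opprB.
have m10 : Num.min 1 0 = 0 :> R by rewrite min_r.
by case: (leP 0 r) => ?; case: (leP 0 s) => ?; case: (leP 1 r) => ?; case: (leP 1 s) => ?;
  rewrite ?m10 ler_norml; apply/andP; split; lra.
Qed.

Lemma ap_clip a : almost_periodic a -> almost_periodic (clip a).
Proof.
move=> apa; apply: (@ap_lip2 1 a a) => // g h; rewrite mul1r.
apply: (@le_trans _ _ (nrm (act g a - act h a))); last by rewrite lerDl.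
by apply: ler_nrm => x; exact: clip_contract.
Qed.

Lemma ap_act k a : almost_periodic a -> almost_periodic (act k a).
Proof.
move=> apa; apply: (@ap_lip2 1 a a) => // g h; rewrite mul1r.
by rewrite -!actD !(addrC _ k) !actD -raddfB nrm_act lerDl.
Qed.

Lemma ap_cb r : almost_periodic (cb r).
Proof.
apply: (@tbd_le _ _ (fun _ _ => 0) _ 0) => [//|g h|]; last exact: (@tbd0 R G 0).
by rewrite !act_cb subrr nrm0 mulr0.
Qed.

Lemma ap_lim c : (forall e, 0 < e -> exists2 a, almost_periodic a & nrm (c - a) <= e) ->
  almost_periodic c.
Proof.
move=> H e e0; have e3 : 0 < e / 3 by rewrite divr_gt0.
have [a apa ca] := H _ e3; have [s sP] := apa _ e3.
exists s => g; have [h hs gh] := sP g; exists h => //.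
have := nrm_tri P (act g a) (act g c) (act h c).
have := nrm_tri P (act h a) (act g a) (act h c).
have := nrm_act Hact g (c - a); have := nrm_act Hact h (c - a).
rewrite !raddfB /= (nrmC _ (act h c)); lra.
Qed.

(** Each [g] is [x + phi k] with [x] among finitely many representatives, and [act x] is an
    isometry, so a net for the orbit along [phi] gives one for the whole orbit. *)
Lemma ap_finite_index (phi : G -> G) c : finite_index (range phi) ->
  totally_bdd (fun g h => nrm (act (phi g) c - act (phi h) c)) -> almost_periodic c.
Proof.
move=> [cs csP] tc e e0; have [s sP] := tc e e0.
exists [seq x + phi h | x <- cs, h <- s] => g.
have [x xcs [k _ kx]] := csP g; have [h hs kh] := sP k.
exists (x + phi h); first by apply/allpairsP; exists (x, h).
have -> : g = x + phi k by rewrite kx addrC subrK.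
by rewrite !actD -raddfB nrm_act.
Qed.

Lemma ap_joint_cover a (phi psi : G -> G) (e : R) : almost_periodic a -> 0 < e ->
  exists s : seq G, forall g, exists2 h, h \in s &
    nrm (act (phi g) a - act (phi h) a) + nrm (act (psi g) a - act (psi h) a) <= e.
Proof.
move=> apa; apply: (tbdD (0 : G) (tri_nrm (fun g => act (phi g) a))
  (tri_nrm (fun g => act (psi g) a))).
- exact: (tbd_comp (0 : G) phi (tri_nrm (act ^~ a)) apa).
- exact: (tbd_comp (0 : G) psi (tri_nrm (act ^~ a)) apa).
Qed.

Lemma nrm_act_morphB (f : G -> G) a k g h : {morph f : g h / g + h} ->
  nrm (act (f (k + g)) a - act (f (k + h)) a) = nrm (act (f g) a - act (f h) a).
Proof. by move=> fD; rewrite !fD !actD -raddfB nrm_act. Qed.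

Let unit_valued a := forall x, 0 <= a x <= 1.

Lemma clip_unit_valued a : unit_valued (clip a).
Proof. by move=> x; rewrite /= le_min ler01 le_max lexx ge_min lexx. Qed.

Lemma clip_id a : unit_valued a -> clip a = a.
Proof.
by move=> a01; apply: bfun_ext => x /=; have /andP[? ?] := a01 x;
  rewrite (max_idPr _)// (min_idPr _).
Qed.

Lemma nrm_clipB a b : unit_valued a -> nrm (a - clip b) <= nrm (a - b).
Proof.
move=> a01; rewrite -{1}(clip_id a01); apply: ler_nrm => x; exact: clip_contract.
Qed.

(** The distance to [f] is minimized over almost periodic functions with values in [0, 1].
    Truncation does not increase the distance to [f], so the minimizer is optimal among all almost
    periodic functions, which yields orthogonality. *)
Lemma ap_projection f : unit_valued f -> exists k, [/\ unit_valued k, almost_periodic k &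
  forall c, almost_periodic c -> ip (f - k) c = 0].
Proof.
move=> f01.
pose KK := [set k | unit_valued k /\ almost_periodic k].
pose S := [set ip (f - k) (f - k) | k in KK].
have Slb : has_lbound S by exists 0 => _ [k _ <-]; exact: ip_ge0.
have KK0 : KK (clip 0).
  by split; [exact: clip_unit_valued|apply: ap_clip; rewrite -(rmorph0 cb); exact: ap_cb].
have Sinf : has_inf S by split=> //; exists (ip (f - clip 0) (f - clip 0)), (clip 0).
have h0 n : 0 < 2^-1 ^+ n :> R by rewrite exprn_gt0// invr_gt0.
(* By the parallelogram identity at the midpoint, two near-minimizers are at squared distance at
   most twice the sum of their slacks, and the factor 1/4 brings this down to [(2^-1 ^+ n) ^+ 2]. *)
have d0 n : 0 < (2^-1 ^+ n) ^+ 2 / 4 :> R by rewrite divr_gt0// exprn_gt0.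
have /choice[k_ k_P] n : exists k, KK k /\
    ip (f - k) (f - k) < inf S + (2^-1 ^+ n) ^+ 2 / 4.
  by have [_ [k KKk <-] lt] := inf_adherent (d0 n) Sinf; exists k.
have leS k : KK k -> inf S <= ip (f - k) (f - k).
  by move=> KKk; apply: ge_inf => //; exists k.
have KKmid a b : KK a -> KK b -> KK (cb 2^-1 * (a + b)).
  move=> [a01 apa] [b01 apb]; split; last exact/apZ/apD.
  move=> x; rewrite bfunM bfunD cbE; have := a01 x; have := b01 x.
  by move=> /andP[? ?] /andP[? ?]; apply/andP; split; lra.
have [||k0 [_ k0P]] := @nrm_complete _ X R P k_ 1.
- move=> n x; have [[k01 _] _] := k_P n; have /andP[? ?] := k01 x.
  by rewrite ger0_norm.
- move=> n j; have [KKn ltn] := k_P n; have [KKj ltj] := k_P (n + j)%N.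
  rewrite nrm_le ?(ltW (h0 n))//.
  have := leS _ (KKmid _ _ KKn KKj).
  have le2 : (2^-1 ^+ (n + j)) ^+ 2 <= (2^-1 ^+ n) ^+ 2 :> R.
    rewrite ler_pXn2r ?nnegrE ?(ltW (h0 _))//.
    by rewrite exprD ler_piMr ?(ltW (h0 _))// exprn_ile1 ?invr_ge0//; lra.
  have -> : f - cb 2^-1 * (k_ n + k_ (n + j)%N) =
      cb 2^-1 * ((f - k_ n) + (f - k_ (n + j)%N)).
    by apply: bfun_ext => x; rewrite !(bfunD, bfunN, bfunM, cbE); lra.
  have -> : k_ n - k_ (n + j)%N = (f - k_ (n + j)%N) - (f - k_ n) by ring.
  move: ltn ltj; move: (f - k_ n) (f - k_ (n + j)%N) => a b.
  rewrite ipBl !ipBr ipZl ipZr ipDl !ipDr (ipC P b a); lra.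
(* Completeness only bounds [|k0|] by 1; truncation restores values in [0, 1] without increasing the
   distance to the [k_ n]. *)
pose k := clip k0.
have kP n : nrm (k_ n - k) <= 2^-1 ^+ n.
  by apply: le_trans (k0P n); apply: nrm_clipB; case: (k_P n) => [[]].
have apk : almost_periodic k.
  apply: ap_lim => e e0; have [n ne] := exists_half_lt e0.
  by exists (k_ n); [case: (k_P n) => [[]]|rewrite nrmC (le_trans (kP n))// ltW].
have kmin z : KK z -> nrm (f - k) <= nrm (f - z).
  move=> KKz; rewrite leNgt; apply/negP => lt.
  have e0 : 0 < (nrm (f - k) - nrm (f - z)) / 2 by rewrite divr_gt0// subr_gt0.
  have [n ne] := exists_half_lt e0.
  have : nrm (f - k_ n) <= nrm (f - z) + 2^-1 ^+ n.
    rewrite nrm_le ?addr_ge0 ?(ltW (h0 n))// sqrrD nrm_sq.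
    have [_ lt'] := k_P n; have := leS _ KKz.
    have := mulr_ge0 (nrm_ge0 P (f - z)) (ltW (h0 n)).
    have := d0 n; lra.
  have := nrm_tri P (k_ n) f k; have := kP n; lra.
exists k; split=> //; first exact: clip_unit_valued.
move=> c apc.
have H t : ip (f - k) (f - k) <= ip (f - k - cb t * c) (f - k - cb t * c).
  have -> : f - k - cb t * c = f - (k + cb t * c) by ring.
  rewrite -!nrm_sq ler_pXn2r ?nnegrE ?nrm_ge0//.
  apply: le_trans (nrm_clipB _ f01); apply: kmin; split; first exact: clip_unit_valued.
  exact/ap_clip/apD/apZ.
move: (f - k) H => u H.
have c1 : 0 < ip c c + 1 by rewrite ltr_wpDl// ip_ge0.
(* Nearly the optimal perturbation along [c]; the [+ 1] covers a [c] of norm 0. *)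
have := H (ip u c / (ip c c + 1)); rewrite ipBl !ipBr !ipZl !ipZr (ipC P c u).
set r := ip u c; set q := ip c c in c1 *.
have -> : ip u u - r / (q + 1) * r - (r / (q + 1) * r - r / (q + 1) * (r / (q + 1) * q)) =
  ip u u - r ^+ 2 * (q + 2) / (q + 1) ^+ 2 by field; rewrite gt_eqF.
rewrite lerBrDr gerDl pmulr_lle0 ?invr_gt0 ?exprn_gt0// pmulr_lle0; last first.
  by rewrite (lt_trans c1)// ltrD2l; lra.
move=> r0; apply/eqP; rewrite -sqrf_eq0 eq_le r0 sqr_ge0 //.
Qed.

End AlmostPeriodic.

(* The left side is the operator with kernel \sum_i r i * v i x * v i y applied to [a];
   the sum on the right is its squared Hilbert-Schmidt norm. *)
Lemma hilbert_schmidt_bound (d : measure_display) (X : measurableType d) (R : realType)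
    (P : probability X R) (I : Type) (s : seq I) (r : I -> R) (v : I -> bfun X R)
    (a : bfun X R) :
  nrm P (\sum_(i <- s) cb (r i * ip P (v i) a) * v i) ^+ 2 <=
  nrm P a ^+ 2 * \sum_(i <- s) \sum_(j <- s) r i * r j * ip P (v i) (v j) ^+ 2.
Proof.
set y := (X in nrm P X ^+ 2 <= _).
pose F x : bfun X R := \sum_(i <- s) cb (r i * v i x) * v i.
pose Q : bfun X R :=
  \sum_(i <- s) \sum_(j <- s) cb (r i * r j * ip P (v i) (v j)) * (v i * v j).
have yx x : y x = ip P (F x) a.
  rewrite /y /F bfun_sum ip_suml; apply: eq_bigr => i _.
  by rewrite bfunM cbE ipZl; ring.
have Qx x : Q x = ip P (F x) (F x).
  rewrite /Q /F bfun_sum ip_suml; apply: eq_bigr => i _.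
  rewrite bfun_sum ip_sumr; apply: eq_bigr => j _.
  by rewrite !bfunM cbE ipZl ipZr; ring.
have -> : \sum_(i <- s) \sum_(j <- s) r i * r j * ip P (v i) (v j) ^+ 2 = EE P Q.
  rewrite /Q raddf_sum; apply: eq_bigr => i _; rewrite raddf_sum.
  by apply: eq_bigr => j _ /=; rewrite EEZ -/(ip P _ _) expr2 mulrA.
rewrite !nrm_sq -EEZ; apply: ler_EE => x.
by rewrite !bfunM cbE yx Qx -expr2 mulrC ip_sq_le.
Qed.

(** * Weak mixing of functions orthogonal to the almost periodic ones *)

Section WeakMixing.
Variables (G : zmodType) (d : measure_display) (X : measurableType d) (R : realType).
Variables (P : probability X R) (T : G -> X -> X).
Hypothesis Hact : mp_action P T.
Notation V := (bfun X R).
Notation EE := (EE P).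
Notation ip := (ip P).
Notation nrm := (nrm P).
Notation act := (act Hact).
Variables (phi : G -> G) (u : V).
Hypothesis phiD : {morph phi : g h / g + h}.

Let U h := act (phi h) u.
(** Finite averages of rank-one operators, whose Hilbert-Schmidt inner products are the
    [ip (U h) (U h') ^+ 2]. *)
Let A (s : seq G) a : V := vavg s (fun h => cb (ip (U h) a) * U h).

Let nrmU h : nrm (U h) = nrm u. Proof. exact: nrm_act. Qed.

Let ipU k h h' : ip (U (h + k)) (U (h' + k)) = ip (U h) (U h').
Proof. by rewrite /U !phiD ![_ + phi k]addrC !actD ip_act. Qed.

(** This is [near_minimizer] in the Hilbert-Schmidt norm. One list [s] works for all [a], which is
    needed to compare [A s] at [a] and at its translates. *)
Lemma hilbert_schmidt_near_invariant (e : R) : 0 < e -> exists2 s, s <> [::] &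
  forall a g, nrm (A s a - A (translate g s) a) <= e * nrm a.
Proof.
move=> e0; pose K g h := ip (U g) (U h) ^+ 2.
have Ksym g h : K g h = K h g by rewrite /K ipC.
have Kinv k g h : K (g + k) (h + k) = K g h by rewrite /K ipU.
have Kpos s : 0 <= avg s (fun g => avg s (K g)).
  rewrite /avg -mulr_sumr !mulr_ge0 ?invr_ge0 ?ler0n//.
  by have := tensor_gram_ge0 P s U U; under eq_bigr do under eq_bigr do rewrite -expr2.
have [s s0 sK] := near_minimizer Ksym Kinv Kpos (exprn_gt0 2 e0).
exists s => // a g.
rewrite -(@ler_pXn2r _ 2) ?nnegrE ?mulr_ge0 ?(ltW e0)//.
pose n : R := (size s)%:R^-1.
(* The difference of the two operators becomes a single weighted sum, as [hilbert_schmidt_bound]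
   expects. *)
pose L := [seq (n, h) | h <- s] ++ [seq (- n, h) | h <- translate g s].
have -> : A s a - A (translate g s) a =
    \sum_(p <- L) cb (p.1 * ip (U p.2) a) * U p.2.
  rewrite /L big_cat !big_map /= /A /vavg size_map -/n big_map !mulr_sumr -sumrN.
  congr (_ + _); apply: eq_bigr => h _; first by rewrite mulrA -rmorphM.
  by rewrite mulrA -rmorphM -mulNr -rmorphN mulNr.
apply: le_trans (hilbert_schmidt_bound _ _ _ _ _) _.
rewrite exprMn mulrC ler_wpM2r ?sqr_ge0//; apply: le_trans (sK g).
have dsum (s1 s2 : seq G) c1 c2 : \sum_(p <- [seq (c1, h) | h <- s1])
    \sum_(q <- [seq (c2, h) | h <- s2]) p.1 * q.1 * ip (U p.2) (U q.2) ^+ 2 =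
    c1 * c2 * \sum_(h <- s1) \sum_(h' <- s2) K h h'.
  rewrite big_map mulr_sumr; apply: eq_bigr => h _; rewrite big_map mulr_sumr.
  by apply: eq_bigr.
rewrite /L big_cat /=; under eq_bigr do rewrite big_cat /=.
under [X in _ + X]eq_bigr do rewrite big_cat /=.
rewrite !big_split /= !dsum.
have -> : \sum_(h <- translate g s) \sum_(h' <- s) K h h' =
    \sum_(h <- s) \sum_(h' <- translate g s) K h h'.
  by rewrite exchange_big; apply: eq_bigr => h _; apply: eq_bigr.
have -> : \sum_(h <- translate g s) \sum_(h' <- translate g s) K h h' =
    \sum_(h <- s) \sum_(h' <- s) K h h'.
  by rewrite big_map; apply: eq_bigr => h _; rewrite big_map; apply: eq_bigr.
rewrite /avg -!mulr_sumr size_map -/n; lra.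
Qed.

Let A_act k s a : act (phi k) (A s a) = A (translate k s) (act (phi k) a).
Proof.
rewrite /A act_vavg vavg_map; apply: eq_vavg => h.
by rewrite rmorphM /= act_cb /U phiD addrC actD ip_act.
Qed.

Hypothesis phi_fi : finite_index (range phi).
Hypothesis uperp : forall c, almost_periodic Hact c -> ip u c = 0.

(** [A s] has finite rank, so the distance is controlled by finitely many bounded coefficients. *)
Let tbd_A s a : totally_bdd (fun k l => nrm (A s (act (phi k) a) - A s (act (phi l) a))).
Proof.
have : totally_bdd (fun k l =>
    \sum_(h <- s) `|ip (U h) (act (phi k) a) - ip (U h) (act (phi l) a)|).
  apply: (tbd_sum (0 : G)) => h; first exact: tri_dist.
  apply: (tbd_real (0 : G)); exists (nrm u * nrm a) => k.
  by apply: le_trans (ip_le _ _ _) _; rewrite nrmU nrm_act.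
apply: (@tbd_le _ _ _ _ ((size s)%:R^-1 * nrm u)).
  by rewrite mulr_ge0 ?invr_ge0 ?ler0n ?nrm_ge0.
move=> k l; rewrite vavgB; apply: le_trans (nrm_vavg_le _ _ _) _.
rewrite /avg -mulrA ler_wpM2l ?invr_ge0// mulr_sumr; apply: ler_sum => h _.
by rewrite -mulrBl -rmorphB nrmZ nrmU mulrC.
Qed.

(** The averages [A s a] tend to some [c], almost periodic because [A s] nearly commutes with the
    action along [phi] and has finite rank. As [u] is orthogonal to almost periodic functions, [c]
    is orthogonal to each [A s a], so its norm is 0; the mean is then bounded through the small
    numbers [ip (A (translate k s) a) a]. *)
Lemma weak_mixing (m : (G -> R) -> R) a : invariant_mean m ->
  m (fun h => ip (act (phi h) u) a ^+ 2) = 0.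
Proof.
move=> hm; have [M uM] := bfun_bdd u.
pose v h := cb (ip (U h) a) * U h.
have vM h x : `|v h x| <= (nrm u * nrm a) * M.
  rewrite /v bfunM cbE normrM; apply: ler_pM => //.
    by apply: le_trans (ip_le _ _ _) _; rewrite nrmU.
  exact: uM.
have a1 : 0 < nrm a + 1 by rewrite ltr_wpDl.
have a1e (e : R) : 0 < e -> e / (nrm a + 1) * nrm a <= e.
  by move=> e0; rewrite mulrAC ler_pdivrMr// mulrDr lerDl mulr1 ltW.
have HS (e : R) : 0 < e -> exists2 s, s <> [::] & forall a' g, nrm a' = nrm a ->
    nrm (A s a' - A (translate g s) a') <= e.
  move=> e0; have [s s0 sP] := hilbert_schmidt_near_invariant (divr_gt0 e0 a1).
  exists s => // a' g a'a; apply: le_trans (sP a' g) _; rewrite a'a; exact: a1e.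
have vI (e : R) : 0 < e -> exists2 s, s <> [::] &
    forall g, nrm (vavg s v - vavg (translate g s) v) <= e.
  by move=> /HS[s s0 sP]; exists s => // g; exact: sP.
have [c [_ cl]] := uniform_limit vM vI.
have apc : almost_periodic Hact c.
  (* Passing from [c] to [A s a] costs [2 e / 12] and commuting with the action [e / 12], whence
     [e / 4] in [near]; two of these and the net of mesh [e / 2] add up to [e]. *)
  apply: (ap_finite_index phi_fi) => e e0; have e12 : 0 < e / 12 by rewrite divr_gt0.
  have [s s0 sP] := HS _ e12; have e2 : 0 < e / 2 by rewrite divr_gt0.
  have [S SP] := @tbd_A s a _ e2.
  have near k : nrm (act (phi k) c - A s (act (phi k) a)) <= e / 4.
    have := cl _ _ e12 s0 (fun g => sP a g erefl); rewrite -/(A s a) => sc.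
    have := nrm_tri P (act (phi k) (A s a)) (act (phi k) c) (A s (act (phi k) a)).
    rewrite -raddfB nrm_act (nrmC _ c (A s a)) A_act.
    have := sP (act (phi k) a) k (nrm_act _ _ _).
    rewrite (nrmC _ _ (A (translate k s) _)); lra.
  exists S => k; have [l lS kl] := SP k; exists l => //.
  have := nrm_tri P (A s (act (phi k) a)) (act (phi k) c) (act (phi l) c).
  have := nrm_tri P (A s (act (phi l) a)) (A s (act (phi k) a)) (act (phi l) c).
  have := near k; have := near l; rewrite (nrmC _ (act (phi l) c)); lra.
have ipAc s : ip (A s a) c = 0.
  rewrite ip_vavgl /avg big1 ?mulr0// => h _.
  have -> : ip (cb (ip (U h) a) * U h) c = ip (U h) a * ip (U h) c by rewrite ipZl.
  by rewrite [ip (U h) c]ip_actl uperp ?mulr0//; exact: ap_act.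
have c0 : nrm c = 0.
  apply/eqP; rewrite eq_le nrm_ge0 andbT leNgt; apply/negP => lt.
  have lt4 : 0 < nrm c / 4 by rewrite divr_gt0.
  have [s s0 sP] := HS _ lt4.
  have sc := cl _ _ lt4 s0 (fun g => sP a g erefl).
  have := ip_le P (c - A s a) c; rewrite ipBl ipAc subr0 nrmC -nrm_sq.
  rewrite ger0_norm ?sqr_ge0//; have := ler_wpM2r (ltW lt) sc; rewrite -/(A s a).
  rewrite expr2; nra.
have brho : bddf (fun h => ip (U h) a ^+ 2).
  exists ((nrm u * nrm a) ^+ 2) => h; rewrite normrX lerXn2r ?nnegrE ?mulr_ge0 ?nrm_ge0//.
  by apply: le_trans (ip_le _ _ _) _; rewrite nrmU.
apply/eqP; rewrite eq_le; apply/andP; split; last first.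
  by apply: (mean_ge0 hm) => // h; exact: sqr_ge0.
rewrite leNgt; apply/negP => lt.
(* The factor [3 * e] in [le3] is [2 * e] for the distance to [c] and [e] for the translate;
   [3 * e * nrm a] stays below [4 * e * (nrm a + 1)], which is the mean itself. *)
have a14 : 0 < 4 * (nrm a + 1) by rewrite mulr_gt0.
have e0 := divr_gt0 lt a14; set e := _ / (4 * _) in e0.
have [s s0 sP] := HS _ e0.
have sc := cl _ _ e0 s0 (fun g => sP a g erefl).
have le3 k : avg s (fun h => ip (U (k + h)) a ^+ 2) <= 3 * e * nrm a.
  have -> : avg s (fun h => ip (U (k + h)) a ^+ 2) = ip (A (translate k s) a) a.
    rewrite ip_vavgl avg_map; apply: eq_avg => h.
    by rewrite ipZl -expr2 addrC.
  apply: le_trans (le_trans (ler_norm _) (ip_le _ _ _)) _; rewrite ler_wpM2r ?nrm_ge0//.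
  have := nrm_tri P (A s a) (A (translate k s) a) 0.
  have := nrm_tri P c (A s a) 0; rewrite !subr0 c0 -/(A s a) in sc *.
  have := sP a k erefl; rewrite nrmC; move: sc; rewrite -/(A s a); lra.
have : m (fun h => ip (U h) a ^+ 2) <= 3 * e * nrm a.
  rewrite -[leLHS](avg_cst _ s0).
  have -> : avg s (fun=> m (fun h => ip (U h) a ^+ 2)) =
      avg s (fun h => m (fun k => ip (U (k + h)) a ^+ 2)).
    by apply: eq_avg => h; rewrite -(mean_shift hm h brho).
  rewrite -(mean_avg hm) => [|h]; last exact: (bddf_comp (fun k => k + h) brho).
  rewrite -[leRHS](mean_cst hm); apply: (ler_mean hm) => //; last exact: bddf_cst.
  rewrite /avg; apply: bddfM; first exact: bddf_cst.
  by apply: bddf_sum => h; exact: (bddf_comp (fun k => k + h) brho).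
rewrite leNgt; apply/negP; rewrite negbK.
have -> : m (fun h => ip (U h) a ^+ 2) = e * (4 * (nrm a + 1)).
  by rewrite /e divfK ?gt_eqF.
have := nrm_ge0 P a; nra.
Qed.

End WeakMixing.

(** * Estimates for nearly orthogonal families *)

Lemma sum_eq_iota_le1 (R : realType) (i n : nat) :
  \sum_(j <- iota 0 n) (i == j)%:R <= 1 :> R.
Proof.
rewrite (eq_bigr (fun j => if i == j then 1 else 0)); last by move=> j _; case: eqP.
rewrite -big_mkcond big_const_seq iter_addr_0 (eq_count (a2 := pred1 i)); last first.
  by move=> j /=; rewrite eq_sym.
by rewrite count_uniq_mem ?iota_uniq// lern1 leq_b1.
Qed.

Lemma double_sum_diag_le (R : realType) (n : nat) (e : R) (c : nat -> nat -> R) :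
  (forall i j, (i < n)%N -> (j < n)%N -> c i j <= (i == j)%:R + e) ->
  \sum_(i <- iota 0 n) \sum_(j <- iota 0 n) c i j <= n%:R * (1 + n%:R * e).
Proof.
have cst (x : R) : \sum_(i <- iota 0 n) x = n%:R * x.
  by rewrite big_const_seq count_predT size_iota iter_addr_0 mulr_natl.
move=> ce; rewrite -cst big_seq [leRHS]big_seq; apply: ler_sum => i.
rewrite mem_iota add0n => lin.
apply: (@le_trans _ _ (\sum_(j <- iota 0 n) ((i == j)%:R + e))).
  rewrite big_seq [leRHS]big_seq; apply: ler_sum => j; rewrite mem_iota add0n.
  exact: ce.
by rewrite big_split /= cst lerD2r; exact: sum_eq_iota_le1.
Qed.

(** Stands in for Cauchy-Schwarz under the mean [m]: the right side is affine in [t ^+ 2], and [l]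
    is chosen at each use. *)
Lemma le_half_amgm (R : realType) (t l : R) : 0 < l -> `|t| <= 2^-1 * (l + l^-1 * t ^+ 2).
Proof.
move=> l0; rewrite -[t ^+ 2]real_normK ?num_real//; set s := `|t|.
have : 0 <= (l - s) ^+ 2 / l by rewrite divr_ge0 ?sqr_ge0 // ltW.
have -> : (l - s) ^+ 2 / l = l - 2 * s + l^-1 * s ^+ 2 by field; rewrite gt_eqF.
lra.
Qed.

(** * Van der Corput differencing with an almost periodic weight *)

Section VanDerCorput.
Variables (G : zmodType) (d : measure_display) (X : measurableType d) (R : realType).
Variables (P : probability X R) (T : G -> X -> X).
Hypothesis Hact : mp_action P T.
Hypothesis Herg : ergodic_action P T.
Hypothesis Gcount : countable [set: G].
Notation V := (bfun X R).
Notation EE := (EE P).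
Notation ip := (ip P).
Notation nrm := (nrm P).
Notation act := (act Hact).

Lemma bddf_ip (I : Type) (x y : I -> V) (M N : R) :
  (forall g, nrm (x g) <= M) -> (forall g, nrm (y g) <= N) ->
  bddf (fun g => ip (x g) (y g)).
Proof.
move=> xM yN; exists (M * N) => g; apply: le_trans (ip_le _ _ _) _.
exact: ler_pM.
Qed.

Variables (phi psi : G -> G).
Hypothesis phiD : {morph phi : g h / g + h}.
Hypothesis psiD : {morph psi : g h / g + h}.
Hypothesis thetafi : finite_index (range (fun g => psi g - phi g)).
Variable m : (G -> R) -> R.
Hypothesis hm : invariant_mean m.
Variables f0 f1 f2 : V.
Hypothesis f0b : forall x, `|f0 x| <= 1.
Hypothesis f1b : forall x, `|f1 x| <= 1.
Hypothesis f2b : forall x, `|f2 x| <= 1.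
Hypothesis f1wm : forall a, m (fun h => ip (act (phi h) f1) a ^+ 2) = 0.

Let theta g := psi g - phi g.
Let a_ h := f1 * act (phi h) f1.
Let b_ h := f2 * act (psi h) f2.

Let nrm_mul1 (a b : V) : (forall x, `|a x| <= 1) -> (forall x, `|b x| <= 1) -> nrm (a * b) <= 1.
Proof.
by move=> a1 b1; apply: nrm_bound; exact: bfunM_le1.
Qed.

Let nrm_a h : nrm (a_ h) <= 1.
Proof. by apply: nrm_mul1 => // x; exact: f1b. Qed.

Let nrm_b h : nrm (b_ h) <= 1.
Proof. by apply: nrm_mul1 => // x; exact: f2b. Qed.

Let corr h g := ip (a_ h) (act (theta g) (b_ h)).

Let corr_le1 h g : `|corr h g| <= 1.
Proof.
apply: le_trans (ip_le _ _ _) _; rewrite nrm_act -(mulr1 1); exact: ler_pM.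
Qed.

Let thetaD : {morph theta : g h / g + h}.
Proof. by move=> g h; rewrite /theta phiD psiD opprD addrACA. Qed.

(** Otherwise [n] such [h] can be chosen with the [a_ h] pairwise almost orthogonal. Their
    correlations, with signs, add up to at least [n * eta], while [mean_tensor_le] bounds the mean
    of [EE (F g ^+ 2)] by [2 * N * n]; these conflict for large [n]. *)
Lemma null_large_correlation (w : G -> R) (eta : R) : (forall g, `|w g| <= 1) -> 0 < eta ->
  null m [set h | eta < `|m (fun g => w g * corr h g)|].
Proof.
move=> w1 eta0; apply: contrapT => notnull.
have [cs csP] := thetafi.
pose N : R := (size cs)%:R.
(* Chosen so that [(n * eta) ^ 2 > 2 * N * n]. *)
pose n := (Num.truncn (2 * N / eta ^+ 2)).+1.
have n0 : 0 < n%:R :> R by rewrite ltr0n.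
have nN : 2 * N < n%:R * eta ^+ 2.
  rewrite -ltr_pdivrMr ?exprn_gt0//.
  have /truncn_itv/andP[] // : 0 <= 2 * N / eta ^+ 2.
  by rewrite divr_ge0 ?mulr_ge0 ?ler0n ?exprn_ge0 ?(ltW eta0).
pose r h h' := `|ip (a_ h) (a_ h')| <= n%:R^-1.
have rnull h : null m [set h' | ~ r h h'].
  have bu : bddf (fun h' => ip (act (phi h') f1) (f1 * a_ h) ^+ 2).
    exists 1 => h'; rewrite normrX exprn_ile1//.
    apply: le_trans (ip_le _ _ _) _; rewrite nrm_act -(mulr1 1); apply: ler_pM => //.
      exact: nrm_bound.
    by apply: le_trans (nrm_mul_le _ _ f1b) _; rewrite mul1r.
  have n20 : 0 < n%:R^-1 ^+ 2 :> R by rewrite exprn_gt0// invr_gt0.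
  apply: (null_sub hm _ (null_markov hm bu (fun h' => sqr_ge0 _) (f1wm (f1 * a_ h)) n20)).
  move=> h' /= /negP; rewrite -ltNge => lt.
  (* Moving a factor [f1] across the inner product exposes [act (phi h') f1], to which weak mixing
     applies. *)
  have -> : ip (act (phi h') f1) (f1 * a_ h) = ip (a_ h) (a_ h').
    by rewrite /ip /a_; congr EE; ring.
  by rewrite -[ltRHS]real_normK ?num_real// ltr_pXn2r ?nnegrE ?invr_ge0 ?ler0n.
have [hh [hD hr]] := exists_pairwise hm notnull rnull n.
pose B i := m (fun g => w g * corr (hh i) g).
pose F g : V := \sum_(i <- iota 0 n) (cb (Num.sg (B i)) * a_ (hh i)) * act (theta g) (b_ (hh i)).
have bw h : bddf (fun g => w g * corr h g).
  by apply: bddfM; [exists 1|exists 1 => g; exact: corr_le1].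
have FE g : EE (F g) = \sum_(i <- iota 0 n) Num.sg (B i) * corr (hh i) g.
  by rewrite raddf_sum; apply: eq_bigr => i _ /=; rewrite -mulrA EEZ.
have sumB : \sum_(i <- iota 0 n) `|B i| = m (fun g => w g * EE (F g)).
  transitivity (m (fun g => \sum_(i <- iota 0 n) Num.sg (B i) * (w g * corr (hh i) g))).
    rewrite (mean_sum hm) => [|i]; last by apply: bddfM => //; exact: bddf_cst.
    by apply: eq_bigr => i _; rewrite (meanZ hm) // -normrEsg.
  congr m; apply/funext => g; rewrite FE mulr_sumr; apply: eq_bigr => i _; ring.
have etaB : n%:R * eta <= \sum_(i <- iota 0 n) `|B i|.
  have -> : n%:R * eta = \sum_(i <- iota 0 n) eta.
    by rewrite big_const_seq count_predT size_iota iter_addr_0 mulr_natl.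
  rewrite big_seq [leRHS]big_seq; apply: ler_sum => i; rewrite mem_iota add0n => lin.
  by apply/ltW/hD.
have F2 : m (fun g => EE (F g ^+ 2)) <= N * (2 * n%:R).
  apply: (le_trans (mean_tensor_le Hact Herg Gcount (iota 0 n)
    (fun i => cb (Num.sg (B i)) * a_ (hh i)) (fun i => b_ (hh i)) hm thetaD csP)).
  rewrite ler_wpM2l ?ler0n//.
  apply: le_trans (@double_sum_diag_le _ n n%:R^-1 _ _) _; last first.
    by rewrite mulfV ?gt_eqF// mulrC.
  move=> i j lin ljn; apply: le_trans (ler_norm _) _.
  rewrite normrM ipZl ipZr !normrM.
  have sg1 (x : R) : `|Num.sg x| <= 1 by rewrite normr_sg lern1 leq_b1.
  have bb : `|ip (b_ (hh i)) (b_ (hh j))| <= 1.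
    by apply: le_trans (ip_le _ _ _) _; rewrite -(mulr1 1); apply: ler_pM.
  have aa : `|ip (a_ (hh i)) (a_ (hh j))| <= (i == j)%:R + n%:R^-1.
    have [ij|ltij|ltji] := ltngtP i j.
    - by rewrite add0r; exact: hr.
    - by rewrite add0r ipC; exact: hr.
    - apply: le_trans (ip_le _ _ _) _.
      apply: (@le_trans _ _ 1); last by rewrite lerDl invr_ge0 ler0n.
      by rewrite -(mulr1 1); apply: ler_pM.
  apply: (@le_trans _ _ (1 * (1 * ((i == j)%:R + n%:R^-1)) * 1)); last by rewrite !mul1r mulr1.
  by apply: ler_pM => //; rewrite ?mulr_ge0//; apply: ler_pM => //; rewrite ?mulr_ge0//;
    apply: ler_pM.
have ln0 : 0 < n%:R * eta by rewrite mulr_gt0.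
have bF : bddf (fun g => EE (F g)).
  rewrite (_ : (fun g => _) = fun g => \sum_(i <- iota 0 n) Num.sg (B i) * corr (hh i) g).
    apply: bddf_sum => i; apply: bddfM; first exact: bddf_cst.
    by exists 1 => g; exact: corr_le1.
  by apply/funext => g; rewrite FE.
have bF2 : bddf (fun g => EE (F g ^+ 2)).
  have nF g : nrm (F g) <= \sum_(i <- iota 0 n) 1.
    rewrite /F; elim: (iota 0 n) => [|i s IHs]; first by rewrite !big_nil nrm0.
    rewrite !big_cons (le_trans (nrmD _ _ _))// lerD//.
    rewrite -mulrA nrmZ -(mulr1 1); apply: ler_pM => //.
      by rewrite normr_sg lern1 leq_b1.
    apply: le_trans (nrm_mul_le (M := 1) _ _ _) _ => [x|].
      by rewrite bfunM normrM -(mulr1 1); apply: ler_pM => //; exact: f1b.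
    by rewrite mul1r nrm_act.
  rewrite (_ : (fun g => _) = fun g => ip (F g) (F g)); last first.
    by apply/funext => g; rewrite expr2.
  exact: (bddf_ip nF nF).
(* This is [le_half_amgm] at [l = n * eta], the lower bound in [etaB]; the term [l / 2] is then
   absorbed by that lower bound. *)
have : m (fun g => w g * EE (F g)) <=
    m (fun g => 2^-1 * (n%:R * eta + (n%:R * eta)^-1 * EE (F g ^+ 2))).
  apply: (ler_mean hm).
  - by apply: bddfM => //; exists 1.
  - apply: bddfM; first exact: bddf_cst.
    apply: bddfD; first exact: bddf_cst.
    by apply: bddfM => //; exact: bddf_cst.
  - move=> g; apply: le_trans (ler_norm _) _; rewrite normrM.
    apply: (@le_trans _ _ `|EE (F g)|); first by rewrite ler_piMl.
    apply: le_trans (le_half_amgm _ ln0) _.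
    rewrite ler_pM2l ?invr_gt0// lerD2l ler_pM2l ?invr_gt0//.
    have := ip_sq_le P (F g) 1; rewrite /ip mulr1 mul1r EE1 mulr1 -expr2; exact.
rewrite -sumB (meanZ hm); last first.
  apply: bddfD; first exact: bddf_cst.
  by apply: bddfM => //; exact: bddf_cst.
rewrite (meanD hm) ?(mean_cst hm) ?(meanZ hm)//; last 2 first.
- exact: bddf_cst.
- by apply: bddfM => //; exact: bddf_cst.
move=> H.
have H2 := le_trans etaB H.
have lninv : 0 < (n%:R * eta)^-1 by rewrite invr_gt0.
have H3 : (n%:R * eta)^-1 * m (fun g => EE (F g ^+ 2)) <= (n%:R * eta)^-1 * (N * (2 * n%:R)).
  by rewrite ler_pM2l.
have H4 : n%:R * eta <= (n%:R * eta)^-1 * (N * (2 * n%:R)) by lra.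
move: H4; rewrite ler_pdivlMl// leNgt => /negP; apply.
rewrite [ltRHS](_ : _ = n%:R * (n%:R * eta ^+ 2)); last by ring.
by rewrite [ltLHS](_ : _ = n%:R * (2 * N)) ?ltr_pM2l//; ring.
Qed.

Variable w : G -> R.
Hypothesis w1 : forall g, `|w g| <= 1.
Hypothesis wap : forall e : R, 0 < e -> exists s : seq G, forall h, exists2 h', h' \in s &
  forall g, `|w (g + h) - w (g + h')| <= e.

Let u_ g : V := cb (w g) * (act (phi g) f1 * act (psi g) f2).

(** Invariance removes [act (phi g)], leaving only the action along [theta]. *)
Let ip_u g h : ip (u_ (g + h)) (u_ g) = w (g + h) * w g * corr h g.
Proof.
rewrite /u_ ipZl ipZr mulrA; congr (_ * _).
rewrite /corr -[RHS](ip_act Hact (phi g)) -actD.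
have -> : phi g + theta g = psi g by rewrite /theta addrC subrK.
by rewrite phiD psiD !actD /a_ /b_ !rmorphM /ip; congr EE; ring.
Qed.

Let nrm_u g : nrm (u_ g) <= 1.
Proof.
rewrite nrmZ -(mulr1 1); apply: ler_pM => //.
by apply: nrm_mul1 => x; [exact: f1b|exact: f2b].
Qed.

Let beta h := m (fun g => ip (u_ (g + h)) (u_ g)).

Let bddf_uu h h' : bddf (fun g => ip (u_ (g + h)) (u_ (g + h'))).
Proof. exact: (bddf_ip (fun g => nrm_u (g + h)) (fun g => nrm_u (g + h'))). Qed.

Let mean_uu h h' : m (fun g => ip (u_ (g + h)) (u_ (g + h'))) = beta (h - h').
Proof.
rewrite /beta; have b : bddf (fun g => ip (u_ (g + (h - h'))) (u_ g)).
  exact: (bddf_ip (fun g => nrm_u (g + (h - h'))) nrm_u).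
rewrite -(mean_shift hm h' b); congr m; apply/funext => g.
by rewrite -addrA [h' + _]addrC subrK.
Qed.

(** [null_large_correlation] needs a weight independent of [h]; almost periodicity replaces
    [w (g + h)] by one of finitely many translates at the cost of half of [eta]. *)
Let null_beta (eta : R) : 0 < eta -> null m [set h | eta < `|beta h|].
Proof.
move=> eta0; have eta2 : 0 < eta / 2 by rewrite divr_gt0.
have [s sP] := wap eta2.
have ww h' g : `|w (g + h') * w g| <= 1.
  by rewrite normrM -(mulr1 1); apply: ler_pM.
apply: (null_sub hm _ (@null_bigcup _ _ _ hm _ s (fun h' => [set h | eta / 2 <
  `|m (fun g => w (g + h') * w g * corr h g)|])
  (fun h' _ => null_large_correlation (ww h') eta2))) => h /= etab.
have [h' h's wh] := sP h; exists h' => //=.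
have bdd k : bddf (fun g => w (g + k) * w g * corr h g).
  by exists 1 => g; rewrite normrM -(mulr1 1); apply: ler_pM.
have : `|beta h - m (fun g => w (g + h') * w g * corr h g)| <= eta / 2.
  have -> : beta h = m (fun g => w (g + h) * w g * corr h g).
    by congr m; apply/funext => g; rewrite ip_u.
  rewrite -(meanB hm) // -[leRHS](mean_cst hm); apply: (ler_norm_mean hm).
  - exact: bddfB.
  - exact: bddf_cst.
  - move=> g; rewrite -mulrBl -mulrBl !normrM -mulrA -[leRHS]mulr1.
    by apply: ler_pM; rewrite ?mulr_ge0// -(mulr1 1); apply: ler_pM.
move=> H; have := ler_normD (beta h - m (fun g => w (g + h') * w g * corr h g))
  (m (fun g => w (g + h') * w g * corr h g)); rewrite subrK; lra.
Qed.

Lemma weighted_mean_eq0 :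
  m (fun g => w g * EE (f0 * act (phi g) f1 * act (psi g) f2)) = 0.
Proof.
set c := m _.
have cE : c = m (fun g => ip (u_ g) f0).
  by congr m; apply/funext => g; rewrite ipZl /ip; congr (_ * EE _); ring.
have nf0 : nrm f0 <= 1 by exact: nrm_bound.
apply/eqP; rewrite -normr_eq0 eq_le normr_ge0 andbT leNgt; apply/negP => c0.
pose k : R := `|c|; have k0 : 0 < k by [].
have k2 : 0 < k ^+ 2 / 4 by rewrite divr_gt0// exprn_gt0.
(* Makes [n%:R^-1] and the off-diagonal bound [k ^+ 2 / 4] add up to less than [k ^+ 2 / 2], whereas
   the final estimate requires at least [k ^+ 2]. *)
pose n := (Num.truncn (4 / k ^+ 2)).+1.
have n0 : 0 < n%:R :> R by rewrite ltr0n.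
have nk : n%:R^-1 < k ^+ 2 / 4.
  rewrite -[ltRHS]invrK ltf_pV2 ?posrE ?invr_gt0// invf_div.
  by have /truncn_itv/andP[] : 0 <= 4 / k ^+ 2 by rewrite divr_ge0 ?exprn_ge0 ?(ltW k0).
have notnull : ~ null m [set: G].
  rewrite /null indicT (mean_cst hm) => /eqP; by rewrite oner_eq0.
have rnull h : null m [set h' | ~ (`|beta (h' - h)| <= k ^+ 2 / 4)].
  apply: (null_sub hm _ (null_shift hm (- h) (null_beta k2))) => h' /= /negP.
  by rewrite -ltNge.
have [hh [_ hr]] := exists_pairwise hm notnull rnull n.
(* Averaging over the shifts [hh i] leaves the mean [c] unchanged but makes the mean squared norm
   small. *)
pose v g : V := vavg (iota 0 n) (fun i => u_ (g + hh i)).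
have s0 : iota 0 n <> [::] by [].
have nv g : nrm (v g) <= 1.
  apply: le_trans (nrm_vavg_le _ _ _) _; rewrite -(avg_cst 1 s0).
  by apply: ler_avg => i.
have bu : bddf (fun g => ip (u_ g) f0).
  exact: (bddf_ip nrm_u (fun=> nf0)).
have cv : c = m (fun g => ip (v g) f0).
  rewrite cE -(avg_cst (m _) s0).
  transitivity (m (fun g => avg (iota 0 n) (fun i => ip (u_ (g + hh i)) f0))).
    rewrite (mean_avg hm) => [|i]; last exact: (bddf_comp (fun g => g + hh i) bu).
    by apply: eq_avg => i; rewrite -(mean_shift hm (hh i) bu).
  by congr m; apply/funext => g; rewrite ip_vavgl.
have bvv : bddf (fun g => ip (v g) (v g)) by exact: (bddf_ip nv nv).
have mvv : m (fun g => ip (v g) (v g)) <= n%:R^-1 + k ^+ 2 / 4.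
  have -> : m (fun g => ip (v g) (v g)) = n%:R^-1 * (n%:R^-1 *
      \sum_(i <- iota 0 n) \sum_(j <- iota 0 n) beta (hh i - hh j)).
    transitivity (m (fun g => avg (iota 0 n) (fun i => avg (iota 0 n) (fun j =>
        ip (u_ (g + hh i)) (u_ (g + hh j)))))).
      by congr m; apply/funext => g; rewrite /v ip_vavg.
    rewrite (mean_avg hm) => [|i]; last first.
      by rewrite /avg; apply: bddfM; [exact: bddf_cst|exact: bddf_sum].
    rewrite {1}/avg size_iota; congr (_ * _); rewrite mulr_sumr; apply: eq_bigr => i _.
    rewrite (mean_avg hm) // /avg size_iota; congr (_ * _); apply: eq_bigr => j _.
    exact: mean_uu.
  rewrite mulrA; apply: (@le_trans _ _ (n%:R^-1 * n%:R^-1 *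
      (n%:R * (1 + n%:R * (k ^+ 2 / 4))))).
    rewrite ler_wpM2l ?mulr_ge0 ?invr_ge0 ?ler0n//; apply: double_sum_diag_le => i j lin ljn.
    apply: le_trans (ler_norm _) _.
    (* [exists_pairwise] only controls [i < j]; the symmetry of [beta] gives the other half. *)
    have bsym x : beta (- x) = beta x.
      rewrite -[- x]sub0r -mean_uu /beta; congr m; apply/funext => g.
      by rewrite addr0 ipC.
    have [ij|ij|->] := ltngtP i j.
    - by rewrite add0r -bsym opprB; exact: hr.
    - by rewrite add0r; exact: hr.
    - rewrite subrr; apply: (@le_trans _ _ 1); last by rewrite lerDl ltW.
      rewrite -(mean_cst hm 1); apply: (ler_norm_mean hm).
      + by rewrite -[X in bddf X]/(fun g => ip (u_ (g + 0)) (u_ g));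
          exact: (bddf_ip (fun g => nrm_u (g + 0)) nrm_u).
      + exact: bddf_cst.
      + by move=> g; apply: le_trans (ip_le _ _ _) _; rewrite -(mulr1 1); apply: ler_pM.
  by rewrite -mulrA mulKf ?gt_eqF// mulrDr mulr1 mulKf ?gt_eqF.
have : `|c| <= m (fun g => 2^-1 * (k + k^-1 * ip (v g) (v g))).
  rewrite cv; apply: (ler_norm_mean hm).
  - exact: (bddf_ip nv (fun=> nf0)).
  - apply: bddfM; first exact: bddf_cst.
    apply: bddfD; first exact: bddf_cst.
    by apply: bddfM => //; exact: bddf_cst.
  - move=> g; apply: le_trans (le_half_amgm _ c0) _.
    rewrite ler_pM2l ?invr_gt0// lerD2l ler_pM2l ?invr_gt0//.
    apply: le_trans (ip_sq_le _ _ _) _; rewrite ler_piMr ?ip_ge0//.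
    by rewrite -nrm_sq exprn_ile1.
rewrite (meanZ hm); last first.
  apply: bddfD; first exact: bddf_cst.
  by apply: bddfM => //; exact: bddf_cst.
rewrite (meanD hm) ?(mean_cst hm) ?(meanZ hm)//; last 2 first.
- exact: bddf_cst.
- by apply: bddfM => //; exact: bddf_cst.
rewrite -/k => H.
have : k <= k^-1 * m (fun g => ip (v g) (v g)) by lra.
rewrite ler_pdivlMl// -expr2; lra.
Qed.

End VanDerCorput.

(** * Return times of the almost periodic part *)

Section Recurrence.
Variables (G : zmodType) (d : measure_display) (X : measurableType d) (R : realType).
Variables (P : probability X R) (T : G -> X -> X).
Hypothesis Hact : mp_action P T.
Notation V := (bfun X R).
Notation EE := (EE P).
Notation ip := (ip P).
Notation nrm := (nrm P).
Notation act := (act Hact).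

(** Jensen's inequality from the tangent line at [c]: [t ^ 3 - 3 c ^ 2 t + 2 c ^ 3] factors as
    [(t - c) ^ 2 (t + 2 c)]. *)
Lemma EE_cube_ge (k : V) : (forall x, 0 <= k x) -> EE k ^+ 3 <= EE (k * k * k).
Proof.
move=> k0; set c := EE k; have c0 : 0 <= c by exact: EE_ge0.
have : 0 <= EE (k * k * k - cb (3 * c ^+ 2) * k + cb (2 * c ^+ 3)).
  apply: EE_ge0 => x; rewrite !(bfunD, bfunN, bfunM, cbE).
  have -> : k x * k x * k x - 3 * c ^+ 2 * k x + 2 * c ^+ 3 =
    (k x - c) ^+ 2 * (k x + 2 * c) by ring.
  by rewrite mulr_ge0 ?sqr_ge0// addr_ge0// mulr_ge0.
rewrite raddfD raddfB /= EEZ EE_cst -/c.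
have -> : 3 * c ^+ 2 * c = 3 * c ^+ 3 by ring.
lra.
Qed.

Variables (phi psi : G -> G).
Hypothesis phiD : {morph phi : g h / g + h}.
Hypothesis psiD : {morph psi : g h / g + h}.

Let retd (k : V) g := nrm (act (phi g) k - k) + nrm (act (psi g) k - k).

Let morph0 (f : G -> G) : {morph f : g h / g + h} -> f 0 = 0.
Proof. by move=> fD; apply: (addrI (f 0)); rewrite -fD !addr0. Qed.

Lemma triple_near (k : V) g : (forall x, 0 <= k x <= 1) ->
  EE k ^+ 3 - retd k g <= EE (k * act (phi g) k * act (psi g) k).
Proof.
move=> k01.
have k1 x : `|k x| <= 1 by have /andP[? ?] := k01 x; rewrite ger0_norm.
have k0 x : 0 <= k x by have /andP[] := k01 x.
have H1 : `|EE (k * act (phi g) k * (act (psi g) k - k))| <= nrm (act (psi g) k - k).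
  apply: le_trans (EE_le_nrm _ _) _; rewrite -[leRHS]mul1r; apply: nrm_mul_le.
  by apply: bfunM_le1 => // x; exact: k1.
have H2 : `|EE (k * k * (act (phi g) k - k))| <= nrm (act (phi g) k - k).
  apply: le_trans (EE_le_nrm _ _) _; rewrite -[leRHS]mul1r; apply: nrm_mul_le.
  exact: bfunM_le1.
have -> : k * act (phi g) k * act (psi g) k =
  k * k * k + (k * k * (act (phi g) k - k) + k * act (phi g) k * (act (psi g) k - k)) by ring.
rewrite raddfD raddfD /=; have := EE_cube_ge k0; rewrite /retd.
by move: H1 H2; rewrite !ler_norml => /andP[? ?] /andP[? ?]; lra.
Qed.

Let weight (k : V) (del : R) g := Num.max 0 (del - retd k g).

(** The action is isometric, so passing from [h] to [h'] changes [retd] by at most the joint orbit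
    distance between [h] and [h'], uniformly in [g]; truncation at 0 is 1-Lipschitz. *)
Lemma weight_ap k (del : R) : almost_periodic Hact k -> forall e : R, 0 < e -> exists s : seq G,
  forall h, exists2 h', h' \in s & forall g, `|weight k del (g + h) - weight k del (g + h')| <= e.
Proof.
move=> apk e e0; have [s sP] := ap_joint_cover phi psi apk e0.
exists s => h; have [h' h's hh'] := sP h; exists h' => // g.
have lip (f : G -> G) : {morph f : g h / g + h} ->
    `|nrm (act (f (g + h)) k - k) - nrm (act (f (g + h')) k - k)| <=
    nrm (act (f h) k - act (f h') k).
  move=> fD; rewrite -(nrm_act_morphB Hact k g h h' fD) ler_norml.
  have := nrm_tri P (act (f (g + h')) k) (act (f (g + h)) k) k.
  have := nrm_tri P (act (f (g + h)) k) (act (f (g + h')) k) k.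
  rewrite (nrmC P (act (f (g + h')) k) (act (f (g + h)) k)).
  by move=> ? ?; apply/andP; split; lra.
have : `|retd k (g + h) - retd k (g + h')| <= e.
  have := lip _ phiD; have := lip _ psiD; rewrite /retd !ler_norml.
  by move=> /andP[? ?] /andP[? ?]; apply/andP; split; lra.
rewrite /weight !ler_norml => /andP[? ?].
by case: (leP 0 (del - retd k (g + h))) => ?; case: (leP 0 (del - retd k (g + h'))) => ?;
  apply/andP; split; lra.
Qed.

(** The [g] that move [k] by at most [del / 2] form a syndetic set, on which the weight is at least
    [del / 2]. *)
Lemma weight_mean_gt0 k (del : R) (m : (G -> R) -> R) :
  invariant_mean m -> almost_periodic Hact k -> 0 < del -> 0 < m (weight k del).
Proof.
move=> hm apk del0; have del2 : 0 < del / 2 by rewrite divr_gt0.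
have syn : syndetic [set g | retd k g <= del / 2].
  have [s sP] := ap_joint_cover phi psi apk del2.
  exists s => x; have [h hs xh] := sP x; exists h => //=; apply: le_trans xh.
  rewrite /retd -(nrm_act_morphB Hact k (- h) x h phiD) -(nrm_act_morphB Hact k (- h) x h psiD).
  by rewrite addNr !morph0// !act0 [- h + x]addrC.
have bw : bddf (weight k del).
  exists del => g; rewrite ger0_norm ?le_max ?lexx// ge_max (ltW del0) /=.
  by rewrite gerBl addr_ge0.
have := mean_syndetic_gt0 hm syn => /(mulr_gt0 del2)/lt_le_trans; apply.
rewrite -(meanZ hm); last exact: bddf_indic.
apply: (ler_mean hm) => //.
  by apply: bddfM; [exact: bddf_cst|exact: bddf_indic].
move=> g; rewrite indicE; case: (boolP (g \in _)) => [|_]; last first.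
  by rewrite mulr0 le_max lexx.
by rewrite inE /= mulr1 le_max => ?; apply/orP; right; lra.
Qed.

End Recurrence.

(** * Comparison of the weighted averages for [f] and for [k] *)

Unset Implicit Arguments.

Theorem theorem1p10 (G : zmodType) (Gcount : countable [set: G])
  (phi psi : {additive G -> G})
  (Hphi : finite_index (range phi))
  (Hpsi : finite_index (range psi))
  (Hdiff : finite_index (range (fun g => phi g - psi g)))
  (R : realType) (d : measure_display) (X : measurableType d)
  (P : probability X R) (T : G -> X -> X)
  (Hsep : separable_prob P)
  (Hact : mp_action P T) (Herg : ergodic_action P T)
  (eps : R) (Heps : 0 < eps) (A : set X) (mA : measurable A) :
  syndetic [set g : G |
    (((fine (P A)) ^+ 3 - eps)%:E < P (A `&` T (phi g) @^-1` A `&` T (psi g) @^-1` A))%E].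
Proof.
set S := [set g | _]; apply: contrapT => nsyn.
have [m hm mS] := nonsyndetic_mean R nsyn.
have phiD : {morph phi : g h / g + h} by exact: raddfD.
have psiD : {morph psi : g h / g + h} by exact: raddfD.
(* The opposite difference is needed too, since the van der Corput argument is used with [phi] and
   [psi] in both orders. *)
have Hdiff' : finite_index (range (fun g => psi g - phi g)).
  have [s sP] := Hdiff; exists s => x; have [c cs [g _ gx]] := sP x.
  by exists c => //; exists (- g) => //; rewrite !raddfN -gx addrC opprK.
pose f : bfun X R := bindic R mA; pose act := act Hact.
have f01 x : 0 <= f x <= 1 by rewrite /= indicE; case: (_ \in _); rewrite ?lexx ?ler01.
have [k [k01 apk kperp]] := ap_projection Hact f01.
pose u := f - k.
have unorm (a : bfun X R) : (forall x, 0 <= a x <= 1) -> forall x, `|a x| <= 1.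
  by move=> a01 x; have /andP[? ?] := a01 x; rewrite ger0_norm.
have f1 := unorm _ f01; have k1 := unorm _ k01.
have u1 x : `|u x| <= 1.
  have /andP[? ?] := f01 x; have /andP[? ?] := k01 x.
  by rewrite bfunD bfunN ler_norml; apply/andP; split; lra.
have wm (th : G -> G) : {morph th : g h / g + h} -> finite_index (range th) ->
    forall a, m (fun h => ip P (act (th h) u) a ^+ 2) = 0.
  by move=> thD thfi a; apply: (weak_mixing thD thfi).
have PA : fine (P A) = EE P f by rewrite -(EE_indic P mA).
(* Orthogonality of [f - k] to the constant 1. *)
have Efk : EE P k = EE P f.
  have := kperp _ (ap_cb Hact 1); rewrite rmorph1 /ip mulr1 raddfB /= => /eqP.
  by rewrite subr_eq0 => /eqP.
pose I g := EE P (f * act (phi g) f * act (psi g) f).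
pose J g := EE P (k * act (phi g) k * act (psi g) k).
have PI g : P (A `&` T (phi g) @^-1` A `&` T (psi g) @^-1` A) = (I g)%:E.
  have mT h : measurable (T h @^-1` A).
    by have := act_measurable Hact h measurableT mA; rewrite setTI.
  have mI : measurable (A `&` T (phi g) @^-1` A `&` T (psi g) @^-1` A).
    by apply: measurableI => //; exact: measurableI.
  rewrite -(EE_indic P mI); congr (EE P _)%:E; apply: bfun_ext => x.
  by rewrite !bfunM /= !indicI.
(* [del <= 1] keeps the weight bounded by 1, and [del <= eps / 2] keeps [eps - del] positive. *)
pose del := Num.min 1 (eps / 2).
have del0 : 0 < del by rewrite lt_min ltr01 divr_gt0.
have [del1 dele] : del <= 1 /\ del <= eps / 2 by rewrite !ge_min !lexx orbT.
pose D g := nrm P (act (phi g) k - k) + nrm P (act (psi g) k - k).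
pose w g := Num.max 0 (del - D g).
have w0 g : 0 <= w g by rewrite le_max lexx.
have wdel g : w g <= del by rewrite ge_max (ltW del0) gerBl addr_ge0.
have w1 g : `|w g| <= 1 by rewrite ger0_norm// (le_trans (wdel g)).
have wap := weight_ap phiD psiD del apk.
have mw : 0 < m w := weight_mean_gt0 phiD psiD hm apk del0.
pose t1 g := EE P (f * act (phi g) u * act (psi g) f).
pose t2 g := EE P (f * act (psi g) u * act (phi g) k).
(* Replacing the factors one at a time gives three terms; the one with [u] in first place vanishes
   because [act (phi g) k * act (psi g) k] is almost periodic. *)
have IJ g : I g - J g = t1 g + t2 g.
  have -> : J g = J g + ip P u (act (phi g) k * act (psi g) k).
    by rewrite kperp ?addr0//; apply: apM; exact: ap_act.
  rewrite /I /J /t1 /t2 /ip -!raddfD -raddfB /=; congr (EE P _).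
  have actu h : act h u = act h f - act h k by exact: raddfB.
  rewrite !actu /u; ring.
have mt1 : m (fun g => w g * t1 g) = 0.
  by apply: (weighted_mean_eq0 Herg Gcount phiD psiD) => //; exact: wm.
(* Here [phi] and [psi] are exchanged and [k] takes the place of [f2]. *)
have mt2 : m (fun g => w g * t2 g) = 0.
  by apply: (weighted_mean_eq0 Herg Gcount psiD phiD) => //; exact: wm.
have bw : bddf w by exists 1.
have bt (a b c : bfun X R) th th' : (forall x, `|a x| <= 1) -> (forall x, `|b x| <= 1) ->
    (forall x, `|c x| <= 1) -> bddf (fun g : G => w g * EE P (a * act (th g) b * act (th' g) c)).
  move=> a1 b1 c1; apply: bddfM => //; exists 1 => g.
  apply: le_trans (EE_le_nrm _ _) _; apply: nrm_bound.
  by apply: bfunM_le1 => [|x]; [apply: bfunM_le1 => // x; exact: b1|exact: c1].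
have bt1 : bddf (fun g => w g * t1 g) by exact: bt.
have bt2 : bddf (fun g => w g * t2 g) by exact: bt.
have bS : bddf (fun g => (1 + eps) * \1_S g).
  by apply: bddfM; [exact: bddf_cst|exact: bddf_indic].
(* Since [J g >= EE P f ^+ 3 - del] where [w g > 0], the left integrand is at most
   [w g * (I g - EE P f ^+ 3 + eps)], which is nonpositive off [S] and at most [1 + eps] on [S].
   Taking means gives [(eps - del) * m w <= 0], a contradiction. *)
have : m (fun g => (eps - del) * w g + (w g * t1 g + w g * t2 g)) <=
    m (fun g => (1 + eps) * \1_S g).
  apply: (ler_mean hm) => //.
    by apply: bddfD; [apply: bddfM => //; exact: bddf_cst|exact: bddfD].
  move=> g; rewrite -mulrDr -IJ.
  have wJ : 0 <= w g * (J g - EE P f ^+ 3 + del).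
    rewrite /w; case: (leP 0 (del - D g)) => Dd; last by rewrite mul0r.
    have := triple_near Hact phi psi g k01; rewrite Efk -/(J g) => HJ.
    rewrite mulr_ge0//; move: HJ Dd; rewrite /D; lra.
  have I1 : I g <= 1.
    apply: le_trans (le_trans (ler_norm _) (EE_le_nrm _ _)) _; apply: nrm_bound.
    by apply: bfunM_le1 => [|x]; [apply: bfunM_le1 => // x|]; exact: f1.
  have E0 : 0 <= EE P f by apply: EE_ge0 => x; have /andP[] := f01 x.
  have E3 : 0 <= EE P f ^+ 3 by rewrite exprn_ge0.
  rewrite indicE; case: (boolP (g \in S)) => [_|].
    have : w g * (I g - EE P f ^+ 3 + eps) <= 1 * (1 + eps).
      apply: (@le_trans _ _ (w g * (1 + eps))); first by rewrite ler_wpM2l//; lra.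
      by rewrite ler_wpM2r//; [lra|exact: le_trans (wdel g) del1].
    rewrite mulr1; nra.
  rewrite notin_setE /S /= PI PA => /negP; rewrite -leNgt lee_fin => Ile.
  have : w g * (I g - EE P f ^+ 3 + eps) <= 0.
    by rewrite mulr_ge0_le0//; lra.
  rewrite mulr0; nra.
have -> : m (fun g => (eps - del) * w g + (w g * t1 g + w g * t2 g)) = (eps - del) * m w.
  rewrite (meanD hm) ?(meanD hm) ?(meanZ hm) ?mt1 ?mt2 ?addr0//; last exact: bddfD.
  by apply: bddfM => //; exact: bddf_cst.
rewrite (meanZ hm) ?mS ?mulr0; last exact: bddf_indic.
by rewrite leNgt mulr_gt0// subr_gt0; lra.
Qed.
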